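(* $\mathbf{IKP}(\mathcal{E})+\Sigma^{\mathcal E}\text{-Reflection}$ is conservative over $\mathbf{IKP}(\mathcal{E})$ for $\Sigma^{\mathcal E}$-sentences.
   Context: $\mathrm{fun}(f,a,b)$ is the bounded formula expressing that $f$ is a function from $a$ to $b$. The language of $\mathbf{IKP}(\mathcal E)$ is that of set theory with, in addition, primitive exponentiation-bounded quantifiers $(\forall x\in{}^ab)$, $(\exists x\in{}^ab)$ (ranging over $x$ with $\mathrm{fun}(x,a,b)$). $\Delta_0^{\mathcal E}$-formulas are those with no unbounded quantifiers. $\mathbf{IKP}(\mathcal E)$ has intuitionistic logic and axioms: Extensionality for $\Delta_0^{\mathcal E}$ formulas, Pair, Union, Infinity, $\Delta_0^{\mathcal E}$-Separation, $\Delta_0^{\mathcal E}$-Collection, Set Induction for all formulas, and Exponentiation $\exists z(\forall x\in{}^ab)(x\in z)$. $\Sigma^{\mathcal E}$- and $\Pi^{\mathcal E}$-formulas: both contain the $\Delta_0^{\mathcal E}$-formulas and are closed under $\wedge,\vee$, $(\forall x\in t),(\exists x\in t),(\forall x\in{}^ab),(\exists x\in{}^ab)$; $\Sigma^{\mathcal E}$ is closed under $\exists x$ and contains $\neg C$, $C\to A$ whenever $A$ is $\Sigma^{\mathcal E}$ and $C$ is $\Pi^{\mathcal E}$; dually $\Pi^{\mathcal E}$ is closed under $\forall x$ and contains $\neg D$, $D\to A$ whenever $A$ is $\Pi^{\mathcal E}$ and $D$ is $\Sigma^{\mathcal E}$. $\Sigma^{\mathcal E}$-Reflection is the schema $A\to\exists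 z\,A^{z}$ for $\Sigma^{\mathcal E}$-formulas $A$, where $A^{z}$ restricts every unbounded quantifier of $A$ to $z$. *)

(* Defs.v *)
(* Syntax and intuitionistic provability for the language of
   IKP(E): set theory with primitive bounded quantifiers (forall x in y),
   (exists x in y) and primitive exponentiation-bounded quantifiers
   (forall f in ^a b), (exists f in ^a b).  Variables are de Bruijn indices;
   there are no function symbols, so terms are just variables (nat). *)
From Stdlib Require Import List Arith.
Import ListNotations.

Inductive form : Type :=
| Mem  : nat -> nat -> form
| Bot  : form
| And  : form -> form -> form
| Or   : form -> form -> form
| Imp  : form -> form -> form
| All  : form -> form
| Ex   : form -> form
| BAll : nat -> form -> form
| BEx  : nat -> form -> form
| EAll : nat -> nat -> form -> form        (* EAll a b A : forall f in ^a b, A *)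
| EEx  : nat -> nat -> form -> form.

Definition Neg (A : form) : form := Imp A Bot.
Definition Iff (A B : form) : form := And (Imp A B) (Imp B A).

Definition up (s : nat -> nat) : nat -> nat :=
  fun n => match n with 0 => 0 | S n => S (s n) end.
Definition scons (x : nat) (s : nat -> nat) : nat -> nat :=
  fun n => match n with 0 => x | S n => s n end.
Definition liftfrom (m d : nat) : nat -> nat :=
  fun n => if n <? m then n else n + d.

Fixpoint rename (s : nat -> nat) (A : form) : form :=
  match A with
  | Mem x y => Mem (s x) (s y)
  | Bot => Bot
  | And B C => And (rename s B) (rename s C)
  | Or B C => Or (rename s B) (rename s C)
  | Imp B C => Imp (rename s B) (rename s C)
  | All B => All (rename (up s) B)
  | Ex B => Ex (rename (up s) B)
  | BAll y B => BAll (s y) (rename (up s) B)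
  | BEx y B => BEx (s y) (rename (up s) B)
  | EAll a b B => EAll (s a) (s b) (rename (up s) B)
  | EEx a b B => EEx (s a) (s b) (rename (up s) B)
  end.

Definition shift (A : form) : form := rename S A.
Definition inst (x : nat) (A : form) : form := rename (scons x (fun n => n)) A.

Fixpoint fvb (n : nat) (A : form) : Prop :=
  match A with
  | Mem x y => x < n /\ y < n
  | Bot => True
  | And B C | Or B C | Imp B C => fvb n B /\ fvb n C
  | All B | Ex B => fvb (S n) B
  | BAll y B | BEx y B => y < n /\ fvb (S n) B
  | EAll a b B | EEx a b B => a < n /\ b < n /\ fvb (S n) B
  end.
Definition sentence (A : form) : Prop := fvb 0 A.

Definition eqf (x y : nat) : form :=
  And (BAll x (Mem 0 (S y))) (BAll y (Mem 0 (S x))).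
Definition sing (z x : nat) : form :=
  And (Mem x z) (BAll z (eqf 0 (S x))).
Definition upair (z x y : nat) : form :=
  And (Mem x z) (And (Mem y z) (BAll z (Or (eqf 0 (S x)) (eqf 0 (S y))))).
Definition opair (p x y : nat) : form :=
  And (BAll p (Or (sing 0 (S x)) (upair 0 (S x) (S y))))
      (And (BEx p (sing 0 (S x))) (BEx p (upair 0 (S x) (S y)))).
Definition inpair (x y f : nat) : form := BEx f (opair 0 (S x) (S y)).
Definition funf (f a b : nat) : form :=
  And (BAll f (BEx (S a) (BEx (S (S b)) (opair 2 1 0))))
  (And (BAll a (BEx (S b) (inpair 1 0 (S (S f)))))
       (BAll a (BAll (S b) (BAll (S (S b))
          (Imp (And (inpair 2 1 (S (S (S f)))) (inpair 2 0 (S (S (S f)))))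
               (eqf 1 0)))))).
Definition succf (x y : nat) : form :=
  And (BAll y (Or (Mem 0 (S x)) (eqf 0 (S x))))
      (And (Mem x y) (BAll x (Mem 0 (S y)))).

Inductive Delta0E : form -> Prop :=
| D_Mem x y : Delta0E (Mem x y)
| D_Bot : Delta0E Bot
| D_And A B : Delta0E A -> Delta0E B -> Delta0E (And A B)
| D_Or A B : Delta0E A -> Delta0E B -> Delta0E (Or A B)
| D_Imp A B : Delta0E A -> Delta0E B -> Delta0E (Imp A B)
| D_BAll y A : Delta0E A -> Delta0E (BAll y A)
| D_BEx y A : Delta0E A -> Delta0E (BEx y A)
| D_EAll a b A : Delta0E A -> Delta0E (EAll a b A)
| D_EEx a b A : Delta0E A -> Delta0E (EEx a b A).

Inductive SigmaE : form -> Prop :=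
| S_D A : Delta0E A -> SigmaE A
| S_And A B : SigmaE A -> SigmaE B -> SigmaE (And A B)
| S_Or A B : SigmaE A -> SigmaE B -> SigmaE (Or A B)
| S_BAll y A : SigmaE A -> SigmaE (BAll y A)
| S_BEx y A : SigmaE A -> SigmaE (BEx y A)
| S_EAll a b A : SigmaE A -> SigmaE (EAll a b A)
| S_EEx a b A : SigmaE A -> SigmaE (EEx a b A)
| S_Ex A : SigmaE A -> SigmaE (Ex A)
| S_Neg C : PiE C -> SigmaE (Neg C)
| S_Imp C A : PiE C -> SigmaE A -> SigmaE (Imp C A)
with PiE : form -> Prop :=
| P_D A : Delta0E A -> PiE A
| P_And A B : PiE A -> PiE B -> PiE (And A B)
| P_Or A B : PiE A -> PiE B -> PiE (Or A B)
| P_BAll y A : PiE A -> PiE (BAll y A)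
| P_BEx y A : PiE A -> PiE (BEx y A)
| P_EAll a b A : PiE A -> PiE (EAll a b A)
| P_EEx a b A : PiE A -> PiE (EEx a b A)
| P_All A : PiE A -> PiE (All A)
| P_Neg D : SigmaE D -> PiE (Neg D)
| P_Imp D A : SigmaE D -> PiE A -> PiE (Imp D A).

(* Axioms of T may contain free variables (parameters); they are used as
   schematic in those variables. *)
Inductive prv (T : form -> Prop) : list form -> form -> Prop :=
| r_ax G A : T A -> prv T G A
| r_hyp G A : In A G -> prv T G A
| r_botE G A : prv T G Bot -> prv T G A
| r_andI G A B : prv T G A -> prv T G B -> prv T G (And A B)
| r_andE1 G A B : prv T G (And A B) -> prv T G A
| r_andE2 G A B : prv T G (And A B) -> prv T G B
| r_orI1 G A B : prv T G A -> prv T G (Or A B)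
| r_orI2 G A B : prv T G B -> prv T G (Or A B)
| r_orE G A B C : prv T G (Or A B) -> prv T (A :: G) C -> prv T (B :: G) C ->
    prv T G C
| r_impI G A B : prv T (A :: G) B -> prv T G (Imp A B)
| r_impE G A B : prv T G (Imp A B) -> prv T G A -> prv T G B
| r_allI G A : prv T (map shift G) A -> prv T G (All A)
| r_allE G A x : prv T G (All A) -> prv T G (inst x A)
| r_exI G A x : prv T G (inst x A) -> prv T G (Ex A)
| r_exE G A C : prv T G (Ex A) -> prv T (A :: map shift G) (shift C) ->
    prv T G C
| r_ballI G y A : prv T (Mem 0 (S y) :: map shift G) A -> prv T G (BAll y A)
| r_ballE G y A x : prv T G (BAll y A) -> prv T G (Mem x y) ->
    prv T G (inst x A)
| r_bexI G y A x : prv T G (Mem x y) -> prv T G (inst x A) ->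
    prv T G (BEx y A)
| r_bexE G y A C : prv T G (BEx y A) ->
    prv T (A :: Mem 0 (S y) :: map shift G) (shift C) -> prv T G C
| r_eallI G a b A : prv T (funf 0 (S a) (S b) :: map shift G) A ->
    prv T G (EAll a b A)
| r_eallE G a b A x : prv T G (EAll a b A) -> prv T G (funf x a b) ->
    prv T G (inst x A)
| r_eexI G a b A x : prv T G (funf x a b) -> prv T G (inst x A) ->
    prv T G (EEx a b A)
| r_eexE G a b A C : prv T G (EEx a b A) ->
    prv T (A :: funf 0 (S a) (S b) :: map shift G) (shift C) -> prv T G C.

(* In each schema, the formula A has its distinguished variable(s) at the
   lowest index(es); its other free variables are parameters. *)
Inductive IKPE_ax : form -> Prop :=
| ax_ext A : Delta0E A ->
    IKPE_ax (All (All (Imp (And (eqf 1 0)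
                                (rename (scons 1 (fun k => k + 2)) A))
                           (rename (liftfrom 1 1) A))))
| ax_pair : IKPE_ax (All (All (Ex (And (Mem 2 0) (Mem 1 0)))))
| ax_union : IKPE_ax (All (Ex (BAll 1 (BAll 0 (Mem 0 2)))))
| ax_inf : IKPE_ax (Ex (And (BEx 0 (BAll 0 Bot)) (BAll 0 (BEx 1 (succf 1 0)))))
| ax_sep A : Delta0E A ->
    IKPE_ax (All (Ex (All (Iff (Mem 0 1)
                               (And (Mem 0 2) (rename (liftfrom 1 2) A))))))
(* Delta0^E-Collection: forall a (forall x in a exists y A(x,y) ->
                          exists z forall x in a exists y in z A(x,y));
   in A, index 0 is y and index 1 is x *)
| ax_coll A : Delta0E A ->
    IKPE_ax (All (Imp (BAll 0 (Ex (rename (liftfrom 2 1) A)))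
                      (Ex (BAll 1 (BEx 1 (rename (liftfrom 2 2) A))))))
| ax_ind A :
    IKPE_ax (Imp (All (Imp (BAll 0 (rename (liftfrom 1 1) A)) A)) (All A))
| ax_exp : IKPE_ax (All (All (Ex (EAll 2 1 (Mem 0 1))))).

Fixpoint relz (z : nat) (A : form) : form :=
  match A with
  | Mem x y => Mem x y
  | Bot => Bot
  | And B C => And (relz z B) (relz z C)
  | Or B C => Or (relz z B) (relz z C)
  | Imp B C => Imp (relz z B) (relz z C)
  | All B => BAll z (relz (S z) B)
  | Ex B => BEx z (relz (S z) B)
  | BAll y B => BAll y (relz (S z) B)
  | BEx y B => BEx y (relz (S z) B)
  | EAll a b B => EAll a b (relz (S z) B)
  | EEx a b B => EEx a b (relz (S z) B)
  end.

Inductive SigmaRef_ax : form -> Prop :=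
| ax_ref A : SigmaE A -> SigmaRef_ax (Imp A (Ex (relz 0 (shift A)))).

Definition IKPE_Ref (A : form) : Prop := IKPE_ax A \/ SigmaRef_ax A.

(* Main.v *)
(* Fix a Delta0 formula Theta(x, c).  Inside IKP(E), a set p is read as the
   condition "for all c in p and all x, Theta(x, c)", a conjunction of Pi
   sentences; star p z bounds x by z, and p establishes a Sigma statement A when
   some z satisfies star p z -> A^z.  Conditions, ordered by inclusion, carry a
   Kripke forcing interpretation made sound for disjunction and existence by the
   nucleus J, a double negation relative to all goals "some y satisfies
   Theta(y, g)" with parameter g.

   If Theta codes the relativizations of the subformulas of A, then a forced
   Sigma formula is established, and a Pi formula all of whose relativizations
   are established is forced; these are proved simultaneously, since the premise
   C of a Sigma implication C -> A can be added to the condition.  Hence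
   Sigma-Reflection is forced, as are the axioms of IKP(E), and the empty
   condition establishes, so IKP(E) proves, every Sigma theorem.  A given proof
   uses finitely many axioms, so one Theta suffices. *)
From Stdlib Require Import List Arith Lia.
From Stdlib Require Import FunctionalExtensionality PropExtensionality ProofIrrelevance.
Require Import Defs.
Import ListNotations.

(** * Renaming and derived rules of the calculus *)

(** Delta0 Collection copes with the connectives and bounded quantifiers that build Sigma formulas;
    the obstacle is [C -> A] with [C] Pi and [A] Sigma. A bound for [A] is available only given [C],
    which is not decidable, and a bound found from [C] need not work from the weaker [C^z]. Hence
    the shape [star p z -> A^z]: the same [z] limits both the assumptions that may be used and the
    conclusion.

    Plain Kripke forcing would not handle disjunctions and bounded existentials of Pi formulas: if
    every [B^z \/ C^z] is established, the disjunct that holds may vary with [z]. Relative to a goal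
    this does no harm: both disjuncts are first made to lead to the goal at one [z], and the
    disjunction is then needed at that [z] only.

    Set Induction has to be forced for every formula, so forcing must be expressible in the
    language. Quantifying over formulas, as goals or as members of conditions, is not; quantifying
    over sets [c] through one Delta0 formula [Theta] is. *)

Lemma up_comp (s t : nat -> nat) : up (fun n => s (t n)) = (fun n => up s (up t n)).
Proof. apply functional_extensionality; intros [|n]; reflexivity. Qed.

Lemma up_id : up (fun n => n) = (fun n => n).
Proof. apply functional_extensionality; intros [|n]; reflexivity. Qed.

Lemma rename_comp (A : form) : forall s t : nat -> nat,
  rename s (rename t A) = rename (fun n => s (t n)) A.
Proof.
  induction A; intros s t; cbn; try rewrite (up_comp s t);
    rewrite ?IHA, ?IHA1, ?IHA2; reflexivity.
Qed.

Lemma rename_id (A : form) : rename (fun n => n) A = A.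
Proof. induction A; cbn; rewrite ?up_id; congruence. Qed.

Lemma fvb_mono (A : form) : forall n m, n <= m -> fvb n A -> fvb m A.
Proof.
  induction A; cbn; intros k m Hk H; repeat match goal with H : _ /\ _ |- _ => destruct H end;
    repeat split; try lia; eauto; eapply IHA; try eassumption; lia.
Qed.

Lemma fvb_exists (A : form) : exists n, fvb n A.
Proof.
  induction A;
    repeat match goal with H : exists n, fvb n ?B |- _ =>
      let k := fresh "k" in destruct H as [k ?] end.
  - exists (S (n + n0)); cbn; lia.
  - exists 0; exact I.
  - exists (k0 + k); cbn; split; eapply fvb_mono; try eassumption; lia.
  - exists (k0 + k); cbn; split; eapply fvb_mono; try eassumption; lia.
  - exists (k0 + k); cbn; split; eapply fvb_mono; try eassumption; lia.
  - exists k; cbn; eapply fvb_mono; try eassumption; lia.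
  - exists k; cbn; eapply fvb_mono; try eassumption; lia.
  - exists (S (n + k)); cbn; split; [lia|]; eapply fvb_mono; try eassumption; lia.
  - exists (S (n + k)); cbn; split; [lia|]; eapply fvb_mono; try eassumption; lia.
  - exists (S (n + n0 + k)); cbn; repeat split; try lia; eapply fvb_mono; try eassumption; lia.
  - exists (S (n + n0 + k)); cbn; repeat split; try lia; eapply fvb_mono; try eassumption; lia.
Qed.

Lemma fvb_exists_list (L : list form) : exists n, forall A, In A L -> fvb n A.
Proof.
  induction L as [|A L [n IH]].
  - exists 0; intros A [].
  - destruct (fvb_exists A) as [m Hm]; exists (n + m); intros B [<-|HB].
    + eapply fvb_mono; [|exact Hm]; lia.
    + eapply fvb_mono; [|exact (IH B HB)]; lia.
Qed.

Lemma rename_ext_fvb (A : form) : forall n (s t : nat -> nat),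
  fvb n A -> (forall k, k < n -> s k = t k) -> rename s A = rename t A.
Proof.
  induction A; cbn; intros k s t H E;
    repeat match goal with H : _ /\ _ |- _ => destruct H end;
    f_equal; eauto; eapply IHA; try eassumption; intros [|j] Hj; cbn; auto with arith;
    f_equal; apply E; lia.
Qed.

Lemma rename_inst (s : nat -> nat) (x : nat) (A : form) :
  rename s (inst x A) = inst (s x) (rename (up s) A).
Proof.
  unfold inst; rewrite !rename_comp; f_equal.
  apply functional_extensionality; intros [|n]; reflexivity.
Qed.

Lemma rename_shift (s : nat -> nat) (A : form) : rename (up s) (shift A) = shift (rename s A).
Proof. unfold shift; rewrite !rename_comp; reflexivity. Qed.

Lemma rename_funf (s : nat -> nat) (f a b : nat) :
  rename s (funf f a b) = funf (s f) (s a) (s b).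
Proof. reflexivity. Qed.

Lemma map_rename_shift (s : nat -> nat) (G : list form) :
  map (rename (up s)) (map shift G) = map shift (map (rename s) G).
Proof. rewrite !map_map; apply map_ext; intros; apply rename_shift. Qed.

(** The fresh variable [n] lies above all free variables of [L]. The renaming that sends it to 0 and
    every other [k] to [S k] acts on [L] as the shift and undoes instantiation at [n], which turns a
    proof about a fresh variable into the eigenvariable form of the rules. *)
Lemma fresh_rename (L : list form) :
  exists x s, forall A, In A L -> rename s A = shift A /\ rename s (inst x A) = A.
Proof.
  destruct (fvb_exists_list L) as [n Hn].
  exists n, (fun k => if k =? n then 0 else S k); intros A HA; specialize (Hn A HA); split.
  - eapply rename_ext_fvb; [exact Hn|]; intros k Hk; cbn.
    destruct (Nat.eqb_spec k n); [lia|reflexivity].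
  - unfold inst; rewrite rename_comp; rewrite <- (rename_id A) at 2.
    eapply rename_ext_fvb; [exact Hn|]; intros [|k] Hk; cbn.
    + now rewrite Nat.eqb_refl.
    + destruct (Nat.eqb_spec k n); [lia|reflexivity].
Qed.

Section Calculus.
Variable T : form -> Prop.

Lemma incl_cons2 (A : form) (G H : list form) : incl G H -> incl (A :: G) (A :: H).
Proof. intros I; apply incl_cons; [left; reflexivity | apply incl_tl, I]. Qed.

Lemma prv_weak (G : list form) (A : form) :
  prv T G A -> forall H, incl G H -> prv T H A.
Proof.
  induction 1; intros K HK;
    [ apply r_ax | apply r_hyp | apply r_botE | apply r_andI | eapply r_andE1 | eapply r_andE2
    | apply r_orI1 | apply r_orI2 | eapply r_orE | apply r_impI | eapply r_impE | apply r_allI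
    | apply r_allE | apply r_exI with (x := x) | eapply r_exE | apply r_ballI
    | apply r_ballE with (y := y) | apply r_bexI with (x := x) | eapply r_bexE | apply r_eallI
    | apply r_eallE with (a := a) (b := b) | apply r_eexI with (x := x) | eapply r_eexE ];
    eauto using incl_cons2, incl_map.
Qed.

Hypothesis T_rename : forall s A, T A -> T (rename s A).

Lemma prv_rename (G : list form) (A : form) :
  prv T G A -> forall s, prv T (map (rename s) G) (rename s A).
Proof.
  induction 1; intros s; cbn in *; try rewrite rename_inst in *.
  - apply r_ax; auto.
  - apply r_hyp, in_map; auto.
  - apply r_botE; auto.
  - apply r_andI; auto.
  - eapply r_andE1; eauto.
  - eapply r_andE2; eauto.
  - apply r_orI1; auto.
  - apply r_orI2; auto.
  - eapply r_orE; eauto.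
  - apply r_impI; auto.
  - eapply r_impE; eauto.
  - apply r_allI; rewrite <- map_rename_shift; auto.
  - eapply r_allE; eauto.
  - specialize (IHprv s); rewrite rename_inst in IHprv; eapply r_exI; eauto.
  - eapply r_exE; [eauto|]; rewrite <- map_rename_shift, <- rename_shift; auto.
  - apply r_ballI; rewrite <- map_rename_shift; apply (IHprv (up s)).
  - eapply r_ballE; eauto; apply IHprv1.
  - specialize (IHprv2 s); rewrite rename_inst in IHprv2; eapply r_bexI; eauto.
  - eapply r_bexE; [eauto|]; rewrite <- map_rename_shift, <- rename_shift; apply (IHprv2 (up s)).
  - apply r_eallI; rewrite <- map_rename_shift; apply (IHprv (up s)).
  - eapply r_eallE; eauto; apply IHprv2.
  - specialize (IHprv2 s); rewrite rename_inst in IHprv2; eapply r_eexI; [apply IHprv1|]; eauto.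
  - eapply r_eexE; [eauto|]; rewrite <- map_rename_shift, <- rename_shift; apply (IHprv2 (up s)).
Qed.

Lemma map_fresh (s : nat -> nat) (G L : list form) (x : nat) :
  (forall A, In A (G ++ L) -> rename s A = shift A /\ rename s (inst x A) = A) ->
  map (rename s) G = map shift G.
Proof. intros H; apply map_ext_in; intros A HA; apply H, in_or_app; now left. Qed.

(** The point is to replace eigenvariables by quantification over all variables in the metatheory,
    which is how families [nat -> Omega] will interpret the quantifiers. *)
Lemma fresh_intro (H : nat -> form) (H0 : form) (G : list form) (A : form)
  (H_spec : exists B, H0 = B /\ forall x, H x = inst x B) :
  (forall x, prv T (H x :: G) (inst x A)) -> prv T (H0 :: map shift G) A.
Proof.
  destruct H_spec as (B & -> & HB); intros K.
  destruct (fresh_rename (G ++ [A; B])) as (x & s & E).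
  specialize (prv_rename _ _ (K x) s) as P; cbn in P; rewrite HB in P.
  rewrite (map_fresh s G _ x E) in P.
  destruct (E A) as [_ EA]; [apply in_or_app; cbn; tauto|].
  destruct (E B) as [_ EB]; [apply in_or_app; cbn; tauto|].
  now rewrite EA, EB in P.
Qed.

Lemma prv_allI (G : list form) (A : form) :
  (forall x, prv T G (inst x A)) -> prv T G (All A).
Proof.
  intros K; apply r_allI.
  destruct (fresh_rename (G ++ [A])) as (x & s & E).
  specialize (prv_rename _ _ (K x) s) as P.
  rewrite (map_fresh s G _ x E) in P.
  destruct (E A) as [_ EA]; [apply in_or_app; cbn; tauto|].
  now rewrite EA in P.
Qed.

Lemma inst_shift (x : nat) (A : form) : inst x (shift A) = A.
Proof. unfold inst, shift; rewrite rename_comp; apply rename_id. Qed.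

Lemma prv_ballI (G : list form) (y : nat) (A : form) :
  (forall x, prv T (Mem x y :: G) (inst x A)) -> prv T G (BAll y A).
Proof.
  intros K; apply r_ballI, (fresh_intro (fun x => Mem x y)); auto.
  exists (Mem 0 (S y)); auto.
Qed.

Lemma prv_eallI (G : list form) (a b : nat) (A : form) :
  (forall x, prv T (funf x a b :: G) (inst x A)) -> prv T G (EAll a b A).
Proof.
  intros K; apply r_eallI, (fresh_intro (fun x => funf x a b)); auto.
  exists (funf 0 (S a) (S b)); auto.
Qed.

Lemma prv_exE (G : list form) (A C : form) :
  prv T G (Ex A) -> (forall x, prv T (inst x A :: G) C) -> prv T G C.
Proof.
  intros H K; eapply r_exE; [exact H|].
  apply (fresh_intro (fun x => inst x A)); [exists A; auto|].
  intros x; rewrite inst_shift; apply K.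
Qed.

Lemma prv_bexE (G : list form) (y : nat) (A C : form) :
  prv T G (BEx y A) -> (forall x, prv T (inst x A :: Mem x y :: G) C) -> prv T G C.
Proof.
  intros H K; eapply r_bexE; [exact H|].
  (* [fresh_intro] moves a single hypothesis under the shift, so the two hypotheses are packed into
     a conjunction and unpacked afterwards. *)
  assert (P : prv T (And A (Mem 0 (S y)) :: map shift G) (shift C)).
  { apply (fresh_intro (fun x => inst x (And A (Mem 0 (S y))))); [eexists; split; reflexivity|].
    intros x; rewrite inst_shift.
    set (B := inst x (And _ _)).
    assert (Q : prv T (B :: G) (And (inst x A) (Mem x y))) by (apply r_hyp; left; reflexivity).
    eapply r_impE; [eapply r_impE; [|exact (r_andE1 _ _ _ _ Q)]|exact (r_andE2 _ _ _ _ Q)].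
    eapply (prv_weak G); [|apply incl_tl, incl_refl].
    apply r_impI, r_impI; eapply prv_weak; [apply (K x)|].
    intros D [<-|[<-|HD]]; cbn; auto. }
  eapply r_impE.
  - eapply prv_weak; [apply r_impI, P|]; do 2 apply incl_tl; apply incl_refl.
  - apply r_andI; apply r_hyp; cbn; auto.
Qed.

Lemma prv_eexE (G : list form) (a b : nat) (A C : form) :
  prv T G (EEx a b A) -> (forall x, prv T (inst x A :: funf x a b :: G) C) -> prv T G C.
Proof.
  intros H K; eapply r_eexE; [exact H|].
  assert (P : prv T (And A (funf 0 (S a) (S b)) :: map shift G) (shift C)).
  { apply (fresh_intro (fun x => inst x (And A (funf 0 (S a) (S b))))); [eexists; split; reflexivity|].
    intros x; rewrite inst_shift.
    set (B := inst x (And _ _)).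
    assert (Q : prv T (B :: G) (And (inst x A) (funf x a b))) by (apply r_hyp; left; reflexivity).
    eapply r_impE; [eapply r_impE; [|exact (r_andE1 _ _ _ _ Q)]|exact (r_andE2 _ _ _ _ Q)].
    eapply (prv_weak G); [|apply incl_tl, incl_refl].
    apply r_impI, r_impI; eapply prv_weak; [apply (K x)|].
    intros D [<-|[<-|HD]]; cbn; auto. }
  eapply r_impE.
  - eapply prv_weak; [apply r_impI, P|]; do 2 apply incl_tl; apply incl_refl.
  - apply r_andI; apply r_hyp; cbn; auto.
Qed.
End Calculus.

Lemma prv_mono (T T' : form -> Prop) (G : list form) (A : form) :
  (forall B, T B -> T' B) -> prv T G A -> prv T' G A.
Proof. intros HT; induction 1;
    [ apply r_ax | apply r_hyp | apply r_botE | apply r_andI | eapply r_andE1 | eapply r_andE2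
    | apply r_orI1 | apply r_orI2 | eapply r_orE | apply r_impI | eapply r_impE | apply r_allI
    | apply r_allE | apply r_exI with (x := x) | eapply r_exE | apply r_ballI
    | apply r_ballE with (y := y) | apply r_bexI with (x := x) | eapply r_bexE | apply r_eallI
    | apply r_eallE with (a := a) (b := b) | apply r_eexI with (x := x) | eapply r_eexE ];
    eauto. Qed.

Lemma prv_finite (T : form -> Prop) (G : list form) (A : form) :
  prv T G A -> exists L, (forall B, In B L -> T B) /\ prv (fun B => In B L) G A.
Proof.
  set (Q := fun L G A => (forall B, In B L -> T B) /\ prv (fun B => In B L) G A).
  assert (Q0 : forall G A, prv (fun B => In B []) G A -> exists L, Q L G A)
    by (intros G' A' H'; exists []; split; [intros ? []|exact H']).
  assert (Q1 : forall G1 A1 G A, (exists L, Q L G1 A1) ->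
    (forall T', prv T' G1 A1 -> prv T' G A) -> exists L, Q L G A)
    by (intros ? ? ? ? (L & HL & HP) HR; exists L; split; auto).
  assert (Q2 : forall G1 A1 G2 A2 G A, (exists L, Q L G1 A1) -> (exists L, Q L G2 A2) ->
    (forall T', prv T' G1 A1 -> prv T' G2 A2 -> prv T' G A) -> exists L, Q L G A).
  { intros ? ? ? ? ? ? (L1 & HL1 & HP1) (L2 & HL2 & HP2) HR; exists (L1 ++ L2); split.
    - intros ? []%in_app_or; auto.
    - apply HR; eapply prv_mono; try eassumption; intros; apply in_or_app; auto. }
  induction 1.
  1: { exists [A]; split; [intros ? [<-|[]]; assumption|apply r_ax; left; reflexivity]. }
  8: { destruct IHprv1 as (L1 & HL1 & HP1), IHprv2 as (L2 & HL2 & HP2), IHprv3 as (L3 & HL3 & HP3).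
    exists (L1 ++ L2 ++ L3); split.
    - intros ? [|[]%in_app_or]%in_app_or; auto.
    - eapply r_orE; eapply prv_mono; try eassumption; intros; rewrite !in_app_iff; auto. }
  all: try solve [eapply Q2; [exact IHprv1|exact IHprv2|];
    intros; (eapply r_andI + eapply r_impE + eapply r_exE + eapply r_ballE +
      eapply r_bexI + eapply r_bexE + eapply r_eallE + eapply r_eexI + eapply r_eexE); eassumption].
  all: try solve [eapply Q1; [exact IHprv|];
    intros; (eapply r_botE + eapply r_andE1 + eapply r_andE2 + eapply r_orI1 + eapply r_orI2 +
      apply r_impI + apply r_allI + apply r_allE + eapply r_exI + apply r_ballI + apply r_eallI);
    eassumption].
  apply Q0, r_hyp; assumption.
Qed.

Lemma Delta0E_rename (A : form) : Delta0E A -> forall s, Delta0E (rename s A).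
Proof. induction 1; intros s; cbn; constructor; auto. Qed.

Lemma IKPE_ax_rename (s : nat -> nat) (A : form) : IKPE_ax A -> IKPE_ax (rename s A).
Proof.
  destruct 1 as [A HA| | | |A HA|A HA|A|].
  - replace (rename s _) with
      (All (All (Imp (And (eqf 1 0) (rename (scons 1 (fun k => k + 2)) (rename (up s) A)))
                     (rename (liftfrom 1 1) (rename (up s) A))))).
    + apply ax_ext, Delta0E_rename, HA.
    + cbn; rewrite !rename_comp; repeat f_equal; apply functional_extensionality;
        intros [|n]; cbn; rewrite ?Nat.add_1_r, ?(Nat.add_comm _ 2); reflexivity.
  - apply ax_pair.
  - apply ax_union.
  - apply ax_inf.
  - replace (rename s _) with
      (All (Ex (All (Iff (Mem 0 1) (And (Mem 0 2) (rename (liftfrom 1 2) (rename (up s) A))))))).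
    + apply ax_sep, Delta0E_rename, HA.
    + cbn; rewrite !rename_comp; unfold Iff; repeat f_equal; apply functional_extensionality;
        intros [|n]; cbn; rewrite ?Nat.add_1_r, ?(Nat.add_comm _ 2); reflexivity.
  - replace (rename s _) with
      (All (Imp (BAll 0 (Ex (rename (liftfrom 2 1) (rename (up (up s)) A))))
                      (Ex (BAll 1 (BEx 1 (rename (liftfrom 2 2) (rename (up (up s)) A))))))).
    + apply ax_coll, Delta0E_rename, HA.
    + cbn; rewrite !rename_comp; repeat f_equal; apply functional_extensionality;
        intros [|[|n]]; cbn; rewrite ?Nat.add_1_r, ?(Nat.add_comm _ 2); reflexivity.
  - replace (rename s _) with
      (Imp (All (Imp (BAll 0 (rename (liftfrom 1 1) (rename (up s) A))) (rename (up s) A)))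
           (All (rename (up s) A))).
    + apply ax_ind.
    + cbn; rewrite !rename_comp; repeat f_equal; apply functional_extensionality;
        intros [|n]; cbn; rewrite ?Nat.add_1_r, ?(Nat.add_comm _ 2); reflexivity.
  - apply ax_exp.
Qed.

(** * Truth values of the canonical model *)

Notation IKPE_prv := (prv IKPE_ax).

(* A truth value is an upward closed set of contexts that contains [W] as soon
   as, in every extension of [W], each formula it entails is provable.  The
   domain of quantification is the set [nat] of variables; this gives the usual
   quantifiers because contexts are finite, so that fresh variables exist. *)
Definition closed_at (P : list form -> Prop) (W : list form) : Prop :=
  forall W1 C, incl W W1 -> (forall W2, incl W1 W2 -> P W2 -> IKPE_prv W2 C) -> IKPE_prv W1 C.

Record Omega := mkOmega {
  holds : list form -> Prop;
  holds_mono : forall W W', incl W W' -> holds W -> holds W';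
  holds_closed : forall W, closed_at holds W -> holds W }.
Notation "W ||- P" := (holds P W) (at level 70, P at level 69).

Lemma Omega_ext (P Q : Omega) : (forall W, W ||- P <-> W ||- Q) -> P = Q.
Proof.
  destruct P as [P P1 P2], Q as [Q Q1 Q2]; cbn; intros H.
  assert (P = Q) as ->
    by (apply functional_extensionality; intros W; apply propositional_extensionality, H).
  f_equal; apply proof_irrelevance.
Qed.

#[local] Obligation Tactic := idtac.

Program Definition closureO (P : list form -> Prop) : Omega := mkOmega (closed_at P) _ _.
Next Obligation. intros P W W' I H W1 C I1 K; apply H; [eapply incl_tran; eauto|exact K]. Qed.
Next Obligation.
  intros P W H W1 C I1 K; apply (H W1 C I1); intros W2 I2 J; apply (J W2 C (incl_refl _)).
  intros W3 I3; apply K; eapply incl_tran; eauto.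
Qed.

Program Definition prov (A : form) : Omega := mkOmega (fun W => IKPE_prv W A) _ _.
Next Obligation. intros A W W' I H; exact (prv_weak _ _ _ H _ I). Qed.
Next Obligation. intros A W H; apply (H W A (incl_refl _)); auto. Qed.

Program Definition andO (P Q : Omega) : Omega := mkOmega (fun W => W ||- P /\ W ||- Q) _ _.
Next Obligation. intros P Q W W' I []; split; eapply holds_mono; eauto. Qed.
Next Obligation.
  intros P Q W H; split; apply holds_closed; intros W1 C I K; apply H; auto;
    intros W2 I2 []; auto.
Qed.

Program Definition impO (P Q : Omega) : Omega :=
  mkOmega (fun W => forall W', incl W W' -> W' ||- P -> W' ||- Q) _ _.
Next Obligation. intros P Q W W' I H W1 I1 K; apply H; [eapply incl_tran; eauto|exact K]. Qed.
Next Obligation.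
  intros P Q W H W' I HP; apply holds_closed; intros W1 C I1 K; apply H.
  - eapply incl_tran; eauto.
  - intros W2 I2 HI; apply K; auto; apply HI; [apply incl_refl|].
    eapply holds_mono; [|exact HP]; eapply incl_tran; eauto.
Qed.

Program Definition allO (P : nat -> Omega) : Omega := mkOmega (fun W => forall x, W ||- P x) _ _.
Next Obligation. intros P W W' I H x; eapply holds_mono; eauto. Qed.
Next Obligation.
  intros P W H x; apply holds_closed; intros W1 C I K; apply H; auto; intros W2 I2 H2; apply K; auto.
Qed.

Definition orO (P Q : Omega) : Omega := closureO (fun W => W ||- P \/ W ||- Q).
Definition exO (P : nat -> Omega) : Omega := closureO (fun W => exists x, W ||- P x).
Definition botO : Omega := closureO (fun _ => False).
Definition memO (x y : nat) : Omega := prov (Mem x y).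
Definition funO (f a b : nat) : Omega := prov (funf f a b).
Definition ballO (y : nat) (P : nat -> Omega) : Omega := allO (fun x => impO (memO x y) (P x)).
Definition bexO (y : nat) (P : nat -> Omega) : Omega := exO (fun x => andO (memO x y) (P x)).
Definition iffO (P Q : Omega) : Omega := andO (impO P Q) (impO Q P).

Lemma closureO_elim (P : list form -> Prop) (W : list form) (R : Omega) :
  W ||- closureO P -> (forall W', incl W W' -> P W' -> W' ||- R) -> W ||- R.
Proof.
  intros H K; apply holds_closed; intros W1 C I J; apply (H W1 C I).
  intros W2 I2 HP; apply J; auto; apply K; auto; eapply incl_tran; eauto.
Qed.

Lemma closureO_intro (P : list form -> Prop) (W : list form) :
  (forall W', incl W W' -> P W') -> W ||- closureO P.
Proof. intros H W1 C I K; apply K; [apply incl_refl|auto]. Qed.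

Lemma orO_l (P Q : Omega) (W : list form) : W ||- P -> W ||- orO P Q.
Proof. intros H; apply closureO_intro; intros W' I; left; eapply holds_mono; eauto. Qed.
Lemma orO_r (P Q : Omega) (W : list form) : W ||- Q -> W ||- orO P Q.
Proof. intros H; apply closureO_intro; intros W' I; right; eapply holds_mono; eauto. Qed.
Lemma exO_intro (x : nat) (P : nat -> Omega) (W : list form) : W ||- P x -> W ||- exO P.
Proof. intros H; apply closureO_intro; intros W' I; exists x; eapply holds_mono; eauto. Qed.
Lemma bexO_intro (x y : nat) (P : nat -> Omega) (W : list form) :
  W ||- memO x y -> W ||- P x -> W ||- bexO y P.
Proof. intros H1 H2; apply (exO_intro x); split; auto. Qed.
Lemma orO_elim (P Q R : Omega) (W : list form) : W ||- orO P Q ->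
  (forall W', incl W W' -> W' ||- P -> W' ||- R) ->
  (forall W', incl W W' -> W' ||- Q -> W' ||- R) -> W ||- R.
Proof. intros H K L; apply (closureO_elim _ _ _ H); intros W' I []; auto. Qed.
Lemma exO_elim (P : nat -> Omega) (R : Omega) (W : list form) : W ||- exO P ->
  (forall x W', incl W W' -> W' ||- P x -> W' ||- R) -> W ||- R.
Proof. intros H K; apply (closureO_elim _ _ _ H); intros W' I [x]; eauto. Qed.
Lemma botO_elim (R : Omega) (W : list form) : W ||- botO -> W ||- R.
Proof. intros H; apply (closureO_elim _ _ _ H); intros W' I []. Qed.
Lemma impO_app (P Q : Omega) (W : list form) : W ||- impO P Q -> W ||- P -> W ||- Q.
Proof. intros H; apply H, incl_refl. Qed.
Lemma ballO_app (x y : nat) (P : nat -> Omega) (W : list form) :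
  W ||- ballO y P -> W ||- memO x y -> W ||- P x.
Proof. intros H; apply H, incl_refl. Qed.
Lemma holds_eq (P Q : Omega) (W : list form) : W ||- P -> P = Q -> W ||- Q.
Proof. now intros H <-. Qed.

Fixpoint ev (r : nat -> nat) (A : form) : Omega :=
  match A with
  | Mem x y => memO (r x) (r y)
  | Bot => botO
  | And B C => andO (ev r B) (ev r C)
  | Or B C => orO (ev r B) (ev r C)
  | Imp B C => impO (ev r B) (ev r C)
  | All B => allO (fun x => ev (scons x r) B)
  | Ex B => exO (fun x => ev (scons x r) B)
  | BAll y B => ballO (r y) (fun x => ev (scons x r) B)
  | BEx y B => bexO (r y) (fun x => ev (scons x r) B)
  | EAll a b B => allO (fun f => impO (funO f (r a) (r b)) (ev (scons f r) B))
  | EEx a b B => exO (fun f => andO (funO f (r a) (r b)) (ev (scons f r) B))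
  end.

Lemma inst_rename_up (x : nat) (r : nat -> nat) (A : form) :
  inst x (rename (up r) A) = rename (scons x r) A.
Proof.
  unfold inst; rewrite rename_comp; f_equal.
  apply functional_extensionality; intros [|n]; reflexivity.
Qed.

(** The truth lemma of the canonical model. An implication or bounded universal is tested in the
    context extended by its own premise, and the closure in [orO], [exO] and [botO] ranges over the
    conclusions [C] of the elimination rules, so these rules give exactly what it demands. *)
Lemma ev_prov (A : form) : forall r, ev r A = prov (rename r A).
Proof.
  pose proof IKPE_ax_rename as TR.
  assert (hd : forall A W, IKPE_prv (A :: W) A) by (intros; apply r_hyp; left; reflexivity).
  assert (hd2 : forall A B W, IKPE_prv (A :: B :: W) B) by (intros; apply r_hyp; right; left; reflexivity).
  assert (wk : forall (A : form) W, incl W (A :: W)) by (intros; apply incl_tl, incl_refl).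
  assert (wk2 : forall (A B : form) W, incl W (A :: B :: W)) by (intros; apply incl_tl; auto).
  induction A; intros r; apply Omega_ext; intros W; cbn [rename]; split; intros H.
  - exact H.
  - exact H.
  - apply (botO_elim (prov Bot)), H.
  - intros W1 C I _; apply r_botE; exact (prv_weak _ _ _ H _ I).
  - destruct H as [H1 H2]; rewrite IHA1 in H1; rewrite IHA2 in H2; apply r_andI; auto.
  - split; [rewrite IHA1; eapply r_andE1|rewrite IHA2; eapply r_andE2]; exact H.
  - apply (orO_elim _ _ _ _ H); intros W' _ H'; [apply r_orI1|apply r_orI2];
      [rewrite IHA1 in H'|rewrite IHA2 in H']; exact H'.
  - intros W1 C I K; eapply r_orE; [eapply prv_weak; [exact H|exact I]| |]; apply K; auto;
      [left; rewrite IHA1|right; rewrite IHA2]; apply hd.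
  - apply r_impI; assert (K := H (rename r A1 :: W) (wk _ _)); rewrite IHA1, IHA2 in K.
    apply K, hd.
  - intros W' I; rewrite IHA1, IHA2; intros K; eapply r_impE; [|exact K].
    exact (prv_weak _ _ _ H _ I).
  - apply prv_allI; [exact TR|]; intros x; rewrite inst_rename_up.
    specialize (H x); cbn in H; rewrite IHA in H; exact H.
  - intros x; cbn; rewrite IHA, <- inst_rename_up; apply r_allE, H.
  - apply (exO_elim _ _ _ H); intros x W' _ H'; cbn in H'; rewrite IHA, <- inst_rename_up in H'.
    eapply r_exI, H'.
  - intros W1 C I K; eapply prv_exE; [exact TR|eapply prv_weak; [exact H|exact I]|].
    intros x; apply K; auto; exists x; rewrite IHA, <- inst_rename_up; apply hd.
  - apply prv_ballI; [exact TR|]; intros x; rewrite inst_rename_up.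
    assert (K := H x (Mem x (r n) :: W) (wk _ _)); cbv beta in K; rewrite IHA in K; apply K, hd.
  - intros x W' I K; rewrite IHA, <- inst_rename_up; cbn. eapply r_ballE; [exact (prv_weak _ _ _ H _ I)|exact K].
  - apply (exO_elim _ _ _ H); intros x W' _ [H1 H2]; rewrite IHA, <- inst_rename_up in H2.
    eapply r_bexI; [exact H1|exact H2].
  - intros W1 C I K; eapply prv_bexE; [exact TR|eapply prv_weak; [exact H|exact I]|].
    intros x; apply K; auto; exists x; split; [apply hd2|].
    rewrite IHA, <- inst_rename_up; apply hd.
  - apply prv_eallI; [exact TR|]; intros x; rewrite inst_rename_up.
    assert (K := H x (funf x (r n) (r n0) :: W) (wk _ _)); cbv beta in K; rewrite IHA in K; apply K, hd.
  - intros x W' I K; rewrite IHA, <- inst_rename_up; cbn. eapply r_eallE; [exact (prv_weak _ _ _ H _ I)|exact K].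
  - apply (exO_elim _ _ _ H); intros x W' _ [H1 H2]; rewrite IHA, <- inst_rename_up in H2.
    eapply r_eexI; [exact H1|exact H2].
  - intros W1 C I K; eapply prv_eexE; [exact TR|eapply prv_weak; [exact H|exact I]|].
    intros x; apply K; auto; exists x; split; [apply hd2|].
    rewrite IHA, <- inst_rename_up; apply hd.
Qed.

Lemma ev_rename (r s : nat -> nat) (A : form) : ev r (rename s A) = ev (fun n => r (s n)) A.
Proof. rewrite !ev_prov, rename_comp; reflexivity. Qed.

Lemma ev_ext_fvb (n : nat) (r s : nat -> nat) (A : form) :
  fvb n A -> (forall k, k < n -> r k = s k) -> ev r A = ev s A.
Proof. intros; rewrite !ev_prov; f_equal; eapply rename_ext_fvb; eauto. Qed.

Lemma ev_ax (A : form) (W : list form) : IKPE_ax A -> W ||- ev (fun n => n) A.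
Proof. intros H; rewrite ev_prov, rename_id; apply r_ax, H. Qed.

Lemma funO_ev (f a b : nat) (r : nat -> nat) :
  funO f a b = ev (scons f (scons a (scons b r))) (funf 0 1 2).
Proof. rewrite ev_prov, rename_funf; reflexivity. Qed.

(* These tactics move to a larger context and transport all hypotheses to it. *)
Ltac push W W' I :=
  repeat match goal with h : holds ?P W |- _ => apply (holds_mono P W W' I) in h end;
  repeat match goal with h : incl ?V W |- _ => apply (fun k => incl_tran k I) in h end;
  try (clear I; clear W).
Ltac ii h :=
  match goal with |- holds ?P ?W =>
    let W' := fresh "V" in let I := fresh "I" in
    intros W' I h; cbv beta in h; push W W' I end.
Ltac ib x h := intros x; ii h.
Ltac iex H x h :=
  match goal with |- holds ?P ?W =>
    apply (exO_elim _ _ _ H); clear H;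
    let W' := fresh "V" in let I := fresh "I" in
    intros x W' I h; cbv beta in h; push W W' I end.
Ltac ior H h :=
  match goal with |- holds ?P ?W =>
    apply (orO_elim _ _ _ _ H); clear H;
    let W' := fresh "V" in let I := fresh "I" in
    intros W' I h; cbv beta in h; push W W' I end.
Ltac app H := first [apply (impO_app _ _ _ H) | apply (ballO_app _ _ _ _ H)].

(** * Definability and elementary set theory in IKP(E) *)

Arguments holds : simpl never.

(* Beyond the [k] distinguished variables the environment is the identity, so
   that any ambient variable [c] is available as a parameter, at index [k + c].
   The flag of [definable] asks for a Delta0 formula. *)
Definition tail_id (k : nat) (r : nat -> nat) : Prop := forall n, r (k + n) = n.
Definition term_def (k : nat) (t : (nat -> nat) -> nat) : Prop :=
  exists i, forall r, tail_id k r -> t r = r i.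
Definition env_def (k : nat) (e : (nat -> nat) -> nat -> nat) : Prop :=
  exists s, forall r, tail_id k r -> e r = (fun n => r (s n)).
Definition definable (b : bool) (k : nat) (P : (nat -> nat) -> Omega) : Prop :=
  exists A, (b = true -> Delta0E A) /\ forall r, tail_id k r -> P r = ev r A.

Lemma term_def_var (k i : nat) : term_def k (fun r => r i).
Proof. exists i; reflexivity. Qed.
Lemma term_def_const (k c : nat) : term_def k (fun _ => c).
Proof. exists (k + c); intros r H; rewrite H; reflexivity. Qed.
Lemma env_def_const (k : nat) (r0 : nat -> nat) : env_def k (fun _ => r0).
Proof.
  exists (fun n => k + r0 n); intros r H; apply functional_extensionality; intros n; now rewrite H.
Qed.
Lemma env_def_scons (k : nat) (t : (nat -> nat) -> nat) (e : (nat -> nat) -> nat -> nat) :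
  term_def k t -> env_def k e -> env_def k (fun r => scons (t r) (e r)).
Proof.
  intros [i Hi] [s Hs]; exists (scons i s); intros r H.
  rewrite (Hi r H), (Hs r H); apply functional_extensionality; intros [|n]; reflexivity.
Qed.
Lemma env_def_sub (k : nat) (s : nat -> nat) : env_def k (fun r n => r (s n)).
Proof. exists s; reflexivity. Qed.

Lemma tail_id_scons (k x : nat) (r : nat -> nat) : tail_id k r -> tail_id (S k) (scons x r).
Proof. intros H n; apply H. Qed.

Lemma definable_ev (b : bool) (k : nat) (e : (nat -> nat) -> nat -> nat) (A : form) :
  (b = true -> Delta0E A) -> env_def k e -> definable b k (fun r => ev (e r) A).
Proof.
  intros HA [s Hs]; exists (rename s A); split; [intros; apply Delta0E_rename; auto|].
  intros r H; rewrite ev_rename, Hs; auto.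
Qed.

Lemma definable_mem (b : bool) (k : nat) (s t : (nat -> nat) -> nat) :
  term_def k s -> term_def k t -> definable b k (fun r => memO (s r) (t r)).
Proof.
  intros [i Hi] [j Hj]; exists (Mem i j); split; [intros; constructor|].
  intros r H; rewrite Hi, Hj; auto.
Qed.
Lemma definable_fun (b : bool) (k : nat) (f s t : (nat -> nat) -> nat) :
  term_def k f -> term_def k s -> term_def k t -> definable b k (fun r => funO (f r) (s r) (t r)).
Proof.
  intros [h Hh] [i Hi] [j Hj]; exists (funf h i j); split; [intros; repeat constructor|].
  intros r H; rewrite Hh, Hi, Hj, ev_prov, rename_funf; auto.
Qed.
Lemma definable_bot (b : bool) (k : nat) : definable b k (fun _ => botO).
Proof. exists Bot; split; [intros; constructor|reflexivity]. Qed.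
Lemma definable_and (b : bool) (k : nat) (P Q : (nat -> nat) -> Omega) :
  definable b k P -> definable b k Q -> definable b k (fun r => andO (P r) (Q r)).
Proof.
  intros (A & HA & EA) (B & HB & EB); exists (And A B); split; [intros; constructor; auto|].
  intros r H; cbn; now rewrite EA, EB.
Qed.
Lemma definable_or (b : bool) (k : nat) (P Q : (nat -> nat) -> Omega) :
  definable b k P -> definable b k Q -> definable b k (fun r => orO (P r) (Q r)).
Proof.
  intros (A & HA & EA) (B & HB & EB); exists (Or A B); split; [intros; constructor; auto|].
  intros r H; cbn; now rewrite EA, EB.
Qed.
Lemma definable_imp (b : bool) (k : nat) (P Q : (nat -> nat) -> Omega) :
  definable b k P -> definable b k Q -> definable b k (fun r => impO (P r) (Q r)).
Proof.
  intros (A & HA & EA) (B & HB & EB); exists (Imp A B); split; [intros; constructor; auto|].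
  intros r H; cbn; now rewrite EA, EB.
Qed.
Lemma definable_all (k : nat) (Q : nat -> (nat -> nat) -> Omega) :
  definable false (S k) (fun r => Q (r 0) (fun n => r (S n))) ->
  definable false k (fun r => allO (fun x => Q x r)).
Proof.
  intros (A & _ & E); exists (All A); split; [discriminate|]; intros r H; cbn; f_equal.
  apply functional_extensionality; intros x; apply (E (scons x r)), tail_id_scons, H.
Qed.
Lemma definable_ex (k : nat) (Q : nat -> (nat -> nat) -> Omega) :
  definable false (S k) (fun r => Q (r 0) (fun n => r (S n))) ->
  definable false k (fun r => exO (fun x => Q x r)).
Proof.
  intros (A & _ & E); exists (Ex A); split; [discriminate|]; intros r H; cbn; f_equal.
  apply functional_extensionality; intros x; apply (E (scons x r)), tail_id_scons, H.
Qed.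
Lemma definable_ball (b : bool) (k : nat) (t : (nat -> nat) -> nat) (Q : nat -> (nat -> nat) -> Omega) :
  term_def k t -> definable b (S k) (fun r => Q (r 0) (fun n => r (S n))) ->
  definable b k (fun r => ballO (t r) (fun x => Q x r)).
Proof.
  intros [i Hi] (A & HA & E); exists (BAll i A); split; [intros; constructor; auto|].
  intros r H; cbn; rewrite Hi by auto; f_equal.
  apply functional_extensionality; intros x; apply (E (scons x r)), tail_id_scons, H.
Qed.
Lemma definable_bex (b : bool) (k : nat) (t : (nat -> nat) -> nat) (Q : nat -> (nat -> nat) -> Omega) :
  term_def k t -> definable b (S k) (fun r => Q (r 0) (fun n => r (S n))) ->
  definable b k (fun r => bexO (t r) (fun x => Q x r)).
Proof.
  intros [i Hi] (A & HA & E); exists (BEx i A); split; [intros; constructor; auto|].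
  intros r H; cbn; rewrite Hi by auto; f_equal.
  apply functional_extensionality; intros x; apply (E (scons x r)), tail_id_scons, H.
Qed.

Definition eqO (x y : nat) : Omega := andO (ballO x (fun a => memO a y)) (ballO y (fun a => memO a x)).
Definition subO (x y : nat) : Omega := ballO x (fun a => memO a y).

Lemma definable_sub (b : bool) (k : nat) (s t : (nat -> nat) -> nat) :
  term_def k s -> term_def k t -> definable b k (fun r => subO (s r) (t r)).
Proof.
  intros [i Hi] [j Hj]; exists (BAll i (Mem 0 (S j))); split; [repeat constructor|].
  intros r H; cbn; rewrite Hi, Hj; auto.
Qed.
Lemma definable_eq (b : bool) (k : nat) (s t : (nat -> nat) -> nat) :
  term_def k s -> term_def k t -> definable b k (fun r => eqO (s r) (t r)).
Proof. intros; apply definable_and; apply definable_sub; auto. Qed.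

Ltac tm := solve [apply term_def_var | apply term_def_const].
Ltac env := solve [repeat (first [apply env_def_const | apply env_def_sub | apply env_def_scons; [tm|]])].
Ltac dstep := idtac; cbv beta; first
  [ apply definable_bot | apply definable_mem; tm | apply definable_fun; tm | apply definable_eq; tm | apply definable_sub; tm
  | apply definable_and | apply definable_or | apply definable_imp | apply definable_ball; [tm|] | apply definable_bex; [tm|]
  | apply definable_all | apply definable_ex ].

Lemma tail_id0 : tail_id 0 (fun n => n).
Proof. intros n; reflexivity. Qed.
Lemma tail_id1 (x : nat) : tail_id 1 (scons x (fun n => n)).
Proof. apply tail_id_scons, tail_id0. Qed.
Lemma tail_id2 (x y : nat) : tail_id 2 (scons x (scons y (fun n => n))).
Proof. apply tail_id_scons, tail_id1. Qed.

Ltac env_ext := f_equal; apply functional_extensionality; intros [|[|?]]; cbn;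
  rewrite ?Nat.add_1_r, ?(Nat.add_comm _ 2); reflexivity.

Ltac wp H L :=
  match goal with |- holds _ ?W => let T := type of (L W) in let T := eval cbv beta in T in
    assert (H : T) by exact (L W) end.
Ltac wa H P := match goal with |- holds _ ?W => assert (H : holds P W) end.

Section Schemata.
Variable W : list form.

Lemma eqO_subst (P : nat -> Omega) (x y : nat) : definable true 1 (fun r => P (r 0)) ->
  W ||- eqO x y -> W ||- P x -> W ||- P y.
Proof.
  intros (A & HA & E) H1 H2.
  rewrite (E _ (tail_id1 y) : P y = _); rewrite (E _ (tail_id1 x) : P x = _) in H2.
  assert (H := ev_ax _ W (ax_ext A (HA eq_refl)) x y); cbn in H; rewrite !ev_rename in H.
  refine (holds_eq _ _ _ (impO_app _ _ _ H (conj H1 (holds_eq _ _ _ H2 _))) _); env_ext.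
Qed.

Lemma pair_weak (x y : nat) : W ||- exO (fun z => andO (memO x z) (memO y z)).
Proof. exact (ev_ax _ W ax_pair x y). Qed.

Lemma union_weak (a : nat) : W ||- exO (fun u => ballO a (fun y => subO y u)).
Proof. exact (ev_ax _ W ax_union a). Qed.

Lemma separation (P : nat -> Omega) (a : nat) : definable true 1 (fun r => P (r 0)) ->
  W ||- exO (fun z => allO (fun x => iffO (memO x z) (andO (memO x a) (P x)))).
Proof.
  intros (A & HA & E).
  refine (holds_eq _ _ _ (ev_ax _ W (ax_sep A (HA eq_refl)) a) _); cbn.
  apply f_equal, functional_extensionality; intros z.
  apply f_equal, functional_extensionality; intros x.
  rewrite (E _ (tail_id1 x) : P x = _), ev_rename.
  replace (fun n => scons x (scons z (scons a (fun n0 => n0))) (liftfrom 1 2 n))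
    with (scons x (fun n => n)); [reflexivity|].
  apply functional_extensionality; intros [|n]; cbn; rewrite ?(Nat.add_comm _ 2); reflexivity.
Qed.

Lemma collection (R : nat -> nat -> Omega) (a : nat) : definable true 2 (fun r => R (r 1) (r 0)) ->
  W ||- ballO a (fun x => exO (fun y => R x y)) ->
  W ||- exO (fun z => ballO a (fun x => bexO z (fun y => R x y))).
Proof.
  intros (A & HA & E) H.
  assert (E' : forall x y, R x y = ev (scons y (scons x (fun n => n))) A)
    by (intros x y; exact (E _ (tail_id2 y x))).
  refine (holds_eq _ _ _ (impO_app _ _ _ (ev_ax _ W (ax_coll A (HA eq_refl)) a) _) _); cbn.
  - refine (holds_eq _ _ _ H _).
    apply f_equal, functional_extensionality; intros x.
    apply f_equal, functional_extensionality; intros y.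
    rewrite E', ev_rename; env_ext.
  - apply f_equal, functional_extensionality; intros z.
    apply f_equal, functional_extensionality; intros x.
    apply f_equal, functional_extensionality; intros y.
    rewrite E', ev_rename; env_ext.
Qed.

Lemma set_induction (P : nat -> Omega) : definable false 1 (fun r => P (r 0)) ->
  W ||- allO (fun x => impO (ballO x P) (P x)) -> W ||- allO P.
Proof.
  intros (A & _ & E) H.
  assert (E' : P = fun x => ev (scons x (fun n => n)) A)
    by (apply functional_extensionality; intros x; exact (E _ (tail_id1 x))).
  refine (holds_eq _ _ _ (impO_app _ _ _ (ev_ax _ W (ax_ind A)) _) _); cbn.
  - refine (holds_eq _ _ _ H _).
    apply f_equal, functional_extensionality; intros x.
    rewrite E'; f_equal; f_equal; apply functional_extensionality; intros y.
    rewrite ev_rename; env_ext.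
  - now rewrite E'.
Qed.

Lemma exp_weak (a b : nat) :
  W ||- exO (fun z => allO (fun f => impO (funO f a b) (memO f z))).
Proof. exact (ev_ax _ W ax_exp a b). Qed.
End Schemata.

Lemma subO_refl (x : nat) (W : list form) : W ||- subO x x.
Proof. ib a h; exact h. Qed.
Lemma subO_trans (x y z : nat) (W : list form) : W ||- subO x y -> W ||- subO y z -> W ||- subO x z.
Proof. intros h1 h2; ib a h; app (h2 a); app (h1 a); exact h. Qed.
Lemma eqO_refl (x : nat) (W : list form) : W ||- eqO x x.
Proof. split; apply subO_refl. Qed.
Lemma eqO_sym (x y : nat) (W : list form) : W ||- eqO x y -> W ||- eqO y x.
Proof. intros [h1 h2]; split; auto. Qed.
Lemma eqO_trans (x y z : nat) (W : list form) : W ||- eqO x y -> W ||- eqO y z -> W ||- eqO x z.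
Proof. intros [h1 h2] [h3 h4]; split; eapply subO_trans; eauto. Qed.

(** The usual use is with [x = y = z]: the result is a larger bound that has [z] as an element, and
    [star] speaks about the elements of its bound. With [x = y = 0] it merely supplies an inhabited
    set. *)
Lemma insert_weak (x y : nat) (W : list form) : W ||- exO (fun z => andO (memO x z) (subO y z)).
Proof.
  wp H (fun W => pair_weak W x x); iex H s h; destruct h as [h _].
  wp H (fun W => pair_weak W s y); iex H p h'; destruct h' as [h1 h2].
  wp H (fun W => union_weak W p); iex H u h'.
  apply (exO_intro u); split.
  - app (ballO_app s p _ _ h' h1 x); exact h.
  - app (h' y); exact h2.
Qed.

Lemma cup_weak (x y : nat) (W : list form) : W ||- exO (fun z => andO (subO x z) (subO y z)).
Proof.
  wp H (fun W => pair_weak W x y); iex H p h; destruct h as [h1 h2].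
  wp H (fun W => union_weak W p); iex H u h.
  apply (exO_intro u); split; app (h); assumption.
Qed.

Lemma empty_exists (W : list form) : W ||- exO (fun z => ballO z (fun _ => botO)).
Proof.
  assert (H : W ||- exO (fun z => allO (fun x => iffO (memO x z) (andO (memO x 0) botO))))
    by (apply (separation W (fun _ => botO)); repeat dstep).
  iex H z h; apply (exO_intro z); ib x hx; destruct (h x) as [h1 _].
  apply (proj2 (impO_app _ _ _ h1 hx)).
Qed.

Lemma pair_exists (x y : nat) (W : list form) :
  W ||- exO (fun z => andO (andO (memO x z) (memO y z)) (ballO z (fun u => orO (eqO u x) (eqO u y)))).
Proof.
  wp H (fun W => pair_weak W x y); iex H p h; destruct h as [h1 h2].
  wa H (exO (fun z => allO (fun u => iffO (memO u z) (andO (memO u p) (orO (eqO u x) (eqO u y))))))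
    ; [apply (separation _ (fun u => orO (eqO u x) (eqO u y))); repeat dstep|].
  iex H z h; apply (exO_intro z); repeat split.
  - destruct (h x) as [_ k]; app k; split; [exact h1|apply orO_l, eqO_refl].
  - destruct (h y) as [_ k]; app k; split; [exact h2|apply orO_r, eqO_refl].
  - ib u hu; destruct (h u) as [k _]; apply (impO_app _ _ _ k hu).
Qed.

(** Collection gives a set [Z] holding some witness for each index. Monotonicity in the witness lets
    the union of [Z] serve for all indices at once. Boundedness of [I] is needed to turn the class
    of indices into a set by separation. *)
Lemma collection_bound (I : nat -> Omega) (R : nat -> nat -> Omega) (W : list form) :
  definable true 1 (fun r => I (r 0)) -> definable true 2 (fun r => R (r 1) (r 0)) ->
  (forall W x z z', W ||- subO z z' -> W ||- R x z -> W ||- R x z') ->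
  W ||- exO (fun b => allO (fun x => impO (I x) (memO x b))) ->
  W ||- allO (fun x => impO (I x) (exO (fun z => R x z))) ->
  W ||- exO (fun z => allO (fun x => impO (I x) (R x z))).
Proof.
  intros HI HR mono B H; iex B b hb.
  wp Q (fun W => separation W I b HI); iex Q s hs.
  wa C (ballO s (fun x => exO (fun y => R x y))).
  { ib x hx; app (H x); destruct (hs x) as [k _]; apply (impO_app _ _ _ k hx). }
  apply collection in C; [|exact HR]; iex C Z hZ.
  wp U (fun W => union_weak W Z); iex U u hu.
  apply (exO_intro u); ib x hx.
  wa K (bexO Z (fun y => R x y)).
  { app (hZ x); destruct (hs x) as [_ k]; app k; split; [|exact hx]; app (hb x); exact hx. }
  iex K z hz; destruct hz as [hz1 hz2]; apply (mono _ x z); [app (hu z); exact hz1|exact hz2].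
Qed.

(** * Relativization and establishing Sigma formulas *)

Ltac pushI I := match type of I with incl ?W ?W' => push W W' I end.
Definition topO : Omega := impO botO botO.

(** The range [d] of the unbounded quantifiers is a parameter so that truth ([d] total) and
    relativization ([d] the elements of [z]) are two instances, compared by a single monotonicity
    lemma. *)
Fixpoint relD (d : nat -> Omega) (r : nat -> nat) (A : form) : Omega :=
  match A with
  | Mem x y => memO (r x) (r y)
  | Bot => botO
  | And B C => andO (relD d r B) (relD d r C)
  | Or B C => orO (relD d r B) (relD d r C)
  | Imp B C => impO (relD d r B) (relD d r C)
  | All B => allO (fun x => impO (d x) (relD d (scons x r) B))
  | Ex B => exO (fun x => andO (d x) (relD d (scons x r) B))
  | BAll y B => ballO (r y) (fun x => relD d (scons x r) B)
  | BEx y B => bexO (r y) (fun x => relD d (scons x r) B)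
  | EAll a b B => allO (fun f => impO (funO f (r a) (r b)) (relD d (scons f r) B))
  | EEx a b B => exO (fun f => andO (funO f (r a) (r b)) (relD d (scons f r) B))
  end.
Definition rel (z : nat) : (nat -> nat) -> form -> Omega := relD (fun x => memO x z).

Lemma impO_top (P : Omega) : impO topO P = P.
Proof.
  apply Omega_ext; intros W; split; intros H.
  - apply (impO_app _ _ _ H); ii h; exact h.
  - ii h; exact H.
Qed.
Lemma andO_top (P : Omega) : andO topO P = P.
Proof.
  apply Omega_ext; intros W; split; intros H; [apply H|].
  split; [ii h; exact h|exact H].
Qed.

Ltac fx := apply functional_extensionality; intros ?.

Lemma relD_top (A : form) : forall r, relD (fun _ => topO) r A = ev r A.
Proof.
  induction A; intros r; cbn; rewrite ?IHA1, ?IHA2; auto; f_equal; fx;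
    rewrite ?impO_top, ?andO_top, IHA; reflexivity.
Qed.

Lemma relD_Delta0E (d : nat -> Omega) (A : form) : Delta0E A -> forall r, relD d r A = ev r A.
Proof.
  induction 1; intros r; cbn; rewrite ?IHDelta0E1, ?IHDelta0E2; auto; f_equal; fx;
    rewrite IHDelta0E; reflexivity.
Qed.

Lemma ev_relz (A : form) : forall k r, ev r (relz k A) = relD (fun x => memO x (r k)) r A.
Proof.
  induction A; intros k r; cbn; rewrite ?IHA1, ?IHA2; auto;
    unfold ballO, bexO; f_equal; fx; rewrite IHA; reflexivity.
Qed.

Lemma relD_rename (d : nat -> Omega) (A : form) : forall r s,
  relD d r (rename s A) = relD d (fun n => r (s n)) A.
Proof.
  assert (E : forall x r s, (fun n => scons x r (up s n)) = scons x (fun n => r (s n)))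
    by (intros; apply functional_extensionality; intros [|n]; reflexivity).
  induction A; intros r s; cbn; rewrite ?IHA1, ?IHA2; auto; f_equal; fx; rewrite IHA, E; reflexivity.
Qed.

Lemma rel_ev (z : nat) (r : nat -> nat) (A : form) :
  rel z r A = ev (scons z r) (relz 0 (shift A)).
Proof. rewrite ev_relz; unfold shift; rewrite relD_rename; reflexivity. Qed.

Lemma Delta0E_relz (A : form) : forall k, Delta0E (relz k A).
Proof. induction A; intros k; cbn; constructor; auto. Qed.

(* [polar true] is the class Sigma and [polar false] the class Pi, both with
   Delta0 formulas decomposed down to atoms. *)
Fixpoint polar (b : bool) (A : form) : Prop :=
  match A with
  | Mem _ _ | Bot => True
  | And B C | Or B C => polar b B /\ polar b C
  | Imp B C => polar (negb b) B /\ polar b C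
  | All B => b = false /\ polar b B
  | Ex B => b = true /\ polar b B
  | BAll _ B | BEx _ B | EAll _ _ B | EEx _ _ B => polar b B
  end.

Lemma polar_Delta0E (A : form) : Delta0E A -> forall b, polar b A.
Proof. induction 1; intros c; cbn; auto. Qed.

Scheme SigmaE_ind2 := Minimality for SigmaE Sort Prop
  with PiE_ind2 := Minimality for PiE Sort Prop.
Combined Scheme SigmaPi_ind from SigmaE_ind2, PiE_ind2.

Lemma polar_SigmaPi : (forall A, SigmaE A -> polar true A) /\ (forall A, PiE A -> polar false A).
Proof. apply SigmaPi_ind; cbn; auto using polar_Delta0E. Qed.

(** The two classes are designed for this: Sigma has no positive unbounded universal and Pi no
    positive unbounded existential, and an implication exchanges the two directions on its
    premise. *)
Lemma relD_mono (A : form) : forall b, polar b A -> forall W d d' r,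
  (forall W' x, incl W W' -> W' ||- d x -> W' ||- d' x) ->
  if b then W ||- relD d r A -> W ||- relD d' r A else W ||- relD d' r A -> W ||- relD d r A.
Proof.
  induction A; cbn; intros b S W d d' r Hd.
  - destruct b; auto.
  - destruct b; auto.
  - destruct S as [S1 S2]; specialize (IHA1 b S1 W d d' r Hd); specialize (IHA2 b S2 W d d' r Hd).
    destruct b; intros [h1 h2]; split; auto.
  - destruct S as [S1 S2].
    destruct b; intros H; ior H h; [apply orO_l|apply orO_r|apply orO_l|apply orO_r].
    1, 3: eapply (IHA1 _ S1); [|exact h]; intros W' x I'; apply Hd; eapply incl_tran; eauto.
    1, 2: eapply (IHA2 _ S2); [|exact h]; intros W' x I'; apply Hd; eapply incl_tran; eauto.
  - destruct S as [S1 S2].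
    destruct b; intros H; ii h; assert (Hd' : forall W' x, incl V W' -> W' ||- d x -> W' ||- d' x)
      by (intros W' x I'; apply Hd; eapply incl_tran; eauto).
    + apply (IHA2 _ S2 _ _ _ _ Hd'); app H; apply (IHA1 _ S1 _ _ _ _ Hd'), h.
    + apply (IHA2 _ S2 _ _ _ _ Hd'); app H; apply (IHA1 _ S1 _ _ _ _ Hd'), h.
  - destruct S as [-> S]; intros H; ib x h.
    apply (IHA _ S V d d'); [intros W' y I'; apply Hd; eapply incl_tran; eauto|].
    app (H x); apply Hd; auto.
  - destruct S as [-> S]; intros H; iex H x h; destruct h as [h1 h2]; apply (exO_intro x); split.
    + apply Hd; auto.
    + apply (IHA _ S V d d'); [intros W' y I'; apply Hd; eapply incl_tran; eauto|]; exact h2.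
  - destruct b; intros H; ib x h;
      (eapply (IHA _ S V d d'); [intros W' y I'; apply Hd; eapply incl_tran; eauto|]);
      app (H x); exact h.
  - destruct b; intros H; iex H x h; destruct h as [h1 h2]; apply (exO_intro x); (split; [exact h1|]);
      (eapply (IHA _ S V d d'); [intros W' y I'; apply Hd; eapply incl_tran; eauto|]); exact h2.
  - destruct b; intros H; ib x h;
      (eapply (IHA _ S V d d'); [intros W' y I'; apply Hd; eapply incl_tran; eauto|]);
      app (H x); exact h.
  - destruct b; intros H; iex H x h; destruct h as [h1 h2]; apply (exO_intro x); (split; [exact h1|]);
      (eapply (IHA _ S V d d'); [intros W' y I'; apply Hd; eapply incl_tran; eauto|]); exact h2.
Qed.

Lemma rel_up (A : form) (r : nat -> nat) (z z' : nat) (W : list form) : polar true A ->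
  W ||- subO z z' -> W ||- rel z r A -> W ||- rel z' r A.
Proof.
  intros S H; apply (relD_mono A true S); intros W' x I h; push W W' I; app (H x); exact h.
Qed.
Lemma rel_down (A : form) (r : nat -> nat) (z z' : nat) (W : list form) : polar false A ->
  W ||- subO z z' -> W ||- rel z' r A -> W ||- rel z r A.
Proof.
  intros S H; apply (relD_mono A false S); intros W' x I h; push W W' I; app (H x); exact h.
Qed.
Lemma rel_true (A : form) (r : nat -> nat) (z : nat) (W : list form) : polar true A ->
  W ||- rel z r A -> W ||- ev r A.
Proof.
  rewrite <- relD_top; intros S; apply (relD_mono A true S); intros W' x I h; ii k; exact k.
Qed.

Definition D0 (P : Omega) : Prop := forall k, definable true k (fun _ => P).
Definition D1 (P : nat -> Omega) : Prop := forall k t, term_def k t -> definable true k (fun r => P (t r)).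
Definition D2 (P : nat -> nat -> Omega) : Prop :=
  forall k s t, term_def k s -> term_def k t -> definable true k (fun r => P (s r) (t r)).
Definition Up (R : nat -> Omega) : Prop :=
  forall W z z', W ||- subO z z' -> W ||- R z -> W ||- R z'.
Definition Bd (I : nat -> Omega) : Prop :=
  forall W, W ||- exO (fun b => allO (fun x => impO (I x) (memO x b))).

Lemma definable_rel (b : bool) (k : nat) (t : (nat -> nat) -> nat) (e : (nat -> nat) -> nat -> nat)
  (A : form) : term_def k t -> env_def k e -> definable b k (fun r => rel (t r) (e r) A).
Proof.
  intros Ht He.
  destruct (definable_ev b k (fun r => scons (t r) (e r)) (relz 0 (shift A))) as (B & HB & E).
  - intros _; apply Delta0E_relz.
  - apply env_def_scons; auto.
  - exists B; split; auto; intros r H; rewrite rel_ev; auto.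
Qed.

Section Forcing.
Variable Theta : form.
Hypothesis Theta_Delta0 : Delta0E Theta.

Definition Th (x c : nat) : Omega := ev (scons x (scons c (fun n => n))) Theta.
Definition star (p z : nat) : Omega := ballO p (fun a => ballO z (fun x => Th x a)).
Definition est (p : nat) (R : nat -> Omega) : Omega := exO (fun z => impO (star p z) (R z)).
(** The search among the elements of [z] makes the statement monotone in [z], which [Th z g] itself
    need not be. *)
Definition goal (p g : nat) : Omega := est p (fun z => bexO z (fun y => Th y g)).
(** Since goals are indexed by sets [g], this second-order looking nucleus is a first-order formula
    whenever [phi] is. *)
Definition J (phi : nat -> Omega) (p : nat) : Omega :=
  allO (fun g => allO (fun q => impO (subO p q)
    (impO (allO (fun r => impO (subO q r) (impO (phi r) (goal r g)))) (goal q g)))).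

Lemma definable_Th (b : bool) (k : nat) (s t : (nat -> nat) -> nat) :
  term_def k s -> term_def k t -> definable b k (fun r => Th (s r) (t r)).
Proof.
  intros; apply (definable_ev b k (fun r => scons (s r) (scons (t r) (fun n => n)))); auto.
  repeat apply env_def_scons; auto using env_def_const.
Qed.

Ltac dd := repeat first [ apply definable_Th; tm | apply definable_rel; [tm|env]
  | match goal with
    | H : D0 ?P |- definable true _ (fun _ => ?P) => apply H
    | H : D1 ?P |- definable true _ (fun r => ?P _) => apply H; tm
    | H : D2 ?P |- definable true _ (fun r => ?P _ _) => apply H; tm
    end | dstep ].

Lemma definable_star (b : bool) (k : nat) (s t : (nat -> nat) -> nat) :
  term_def k s -> term_def k t -> definable b k (fun r => star (s r) (t r)).
Proof.
  intros [i Hi] [j Hj].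
  assert (H : definable b k (fun r => star (r i) (r j))) by (unfold star; dd).
  destruct H as (A & HA & E); exists A; split; auto; intros r H; rewrite Hi, Hj; auto.
Qed.

Lemma star_anti (p z z' : nat) (W : list form) :
  W ||- subO z z' -> W ||- star p z' -> W ||- star p z.
Proof. intros H1 H2; ib a ha; ib x hx; app (ballO_app _ _ _ _ H2 ha x); app (H1 x); exact hx. Qed.
Lemma star_le (p q z : nat) (W : list form) : W ||- subO p q -> W ||- star q z -> W ||- star p z.
Proof. intros H1 H2; ib a ha; app (H2 a); app (H1 a); exact ha. Qed.

Lemma est_le (p q : nat) (R : nat -> Omega) (W : list form) :
  W ||- subO p q -> W ||- est p R -> W ||- est q R.
Proof.
  intros H1 H2; iex H2 z h; apply (exO_intro z); ii k; app h; eapply star_le; eauto.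
Qed.

Lemma est_enlarge (p : nat) (R R' : nat -> Omega) (W : list form) : W ||- est p R ->
  (forall W' z, incl W W' -> W' ||- exO (fun z' => andO (subO z z') (impO (R z) (R' z')))) ->
  W ||- est p R'.
Proof.
  intros H K; iex H z h; specialize (K V z I); iex K z' k; destruct k as [k1 k2].
  apply (exO_intro z'); ii s; app k2; app h; eapply star_anti; eauto.
Qed.

Lemma est_imp (p : nat) (R R' : nat -> Omega) (W : list form) : W ||- est p R ->
  (forall W' z, incl W W' -> W' ||- R z -> W' ||- R' z) -> W ||- est p R'.
Proof.
  intros H K; apply (est_enlarge _ _ _ _ H); intros W' z I; apply (exO_intro z).
  split; [apply subO_refl|]; ii h; apply K; auto.
Qed.

Lemma est_true (p : nat) (R : nat -> Omega) (z : nat) (W : list form) : W ||- R z -> W ||- est p R.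
Proof. intros H; apply (exO_intro z); ii h; exact H. Qed.

Lemma est_and (p : nat) (R1 R2 R : nat -> Omega) (W : list form) : Up R1 -> Up R2 ->
  W ||- est p R1 -> W ||- est p R2 ->
  (forall W' z, incl W W' -> W' ||- R1 z -> W' ||- R2 z -> W' ||- R z) -> W ||- est p R.
Proof.
  intros U1 U2 H1 H2 K; iex H1 z1 h1; iex H2 z2 h2.
  wp H (fun W => cup_weak z1 z2 W); iex H z hz; destruct hz as [s1 s2].
  apply (exO_intro z); ii h; apply K; auto.
  - apply (U1 _ z1); auto; app h1; apply (star_anti p z1 z); auto.
  - apply (U2 _ z2); auto; app h2; apply (star_anti p z2 z); auto.
Qed.

Lemma Up_const (P : Omega) : Up (fun _ => P).
Proof. intros W z z' _ H; exact H. Qed.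

(** The matrix [star p z -> R x z] is Delta0 and, as [star] is antitone in [z], monotone in [z].
    Collection is therefore applied to the whole implication, and the assumption [star p z] comes
    out uniform in [x]. *)
Lemma est_coll (p : nat) (I : nat -> Omega) (R : nat -> nat -> Omega) (W : list form) :
  D1 I -> Bd I -> D2 R -> (forall x, Up (R x)) ->
  W ||- allO (fun x => impO (I x) (est p (R x))) ->
  W ||- est p (fun z => allO (fun x => impO (I x) (R x z))).
Proof.
  intros DI BI DR U H.
  assert (K : W ||- exO (fun z => allO (fun x => impO (I x) (impO (star p z) (R x z))))).
  { apply (collection_bound I (fun x z => impO (star p z) (R x z))).
    - dd.
    - apply definable_imp; [apply definable_star; tm|dd].
    - intros W' x z z' h1 h2; ii k; apply (U x _ z); auto; app h2; apply (star_anti p z z'); auto.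
    - apply BI.
    - exact H. }
  iex K z h; apply (exO_intro z); ii k; ib x hx.
  apply (impO_app _ _ _ (impO_app _ _ _ (h x) hx) k).
Qed.

(* A Delta0 proposition is a subset of a singleton, so collection lets the
   witness be chosen independently of its truth. *)
Lemma est_imp_prop (p : nat) (P : Omega) (R : nat -> Omega) (W : list form) : D0 P -> D1 R -> Up R ->
  W ||- impO P (est p R) -> W ||- est p (fun z => impO P (R z)).
Proof.
  intros DP DR U H.
  (* [b] is any set with the variable 0 as an element; the subset of [b] cut out by [P] is the index
     class for [est_coll]. *)
  wp K (fun W => insert_weak 0 0 W); iex K b hb; destruct hb as [hb _].
  assert (K : V ||- est p (fun z => allO (fun x => impO (andO (memO x b) P) (R z)))).
  { apply (est_coll p (fun x => andO (memO x b) P) (fun _ => R)); auto.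
    - intros k t Ht; apply definable_and; [apply definable_mem; [exact Ht|tm]|apply DP].
    - intros W'; apply (exO_intro b); ib x hx; apply hx.
    - intros k s t _ Ht; apply DR, Ht.
    - ib x hx; app H; apply hx. }
  apply (est_imp _ _ _ _ K); intros W' z I h; push V W' I; ii k; app (h 0); split; auto.
Qed.

Lemma Up_imp (P : Omega) (R : nat -> Omega) : Up R -> Up (fun z => impO P (R z)).
Proof. intros U W z z' h1 h2; ii k; apply (U _ z); auto; app h2; exact k. Qed.

(** [P] is available only under [star], whereas the bound for [R] must be named before [star] is
    assumed; [est_imp_prop] first makes that bound independent of [P]. *)
Lemma est_cut (p : nat) (P : Omega) (R : nat -> Omega) (W : list form) : D0 P -> D1 R -> Up R ->
  W ||- est p (fun _ => P) -> W ||- impO P (est p R) -> W ||- est p R.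
Proof.
  intros DP DR U H1 H2; apply est_imp_prop in H2; auto.
  apply (est_and _ _ _ _ _ (Up_const P) (Up_imp P R U) H1 H2).
  intros W' z I h1 h2; app h2; exact h1.
Qed.

(** [Q] is established at each [z] separately, with bounds depending on [z]. So the bound [z0] of
    [R] is fixed first, [Q] is taken at [z0] alone, and the larger bound [z] only serves to supply
    both instances of [star]. *)
Lemma est_join (p : nat) (R Q G : nat -> Omega) (W : list form) : Up R -> Up G ->
  W ||- est p R -> W ||- allO (fun z => est p (fun _ => Q z)) ->
  (forall W' z, incl W W' -> W' ||- R z -> W' ||- Q z -> W' ||- G z) -> W ||- est p G.
Proof.
  intros UR UG H1 H2 K; iex H1 z0 h0; pose proof (H2 z0) as H3; iex H3 z1 h1.
  wp H (fun W => cup_weak z0 z1 W); iex H z hz; destruct hz as [s1 s2].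
  apply (exO_intro z); ii h; apply (UG _ z0); auto; apply K; auto.
  - app h0; apply (star_anti p z0 z); auto.
  - app h1; apply (star_anti p z1 z); auto.
Qed.

Definition goal_at (g z : nat) : Omega := bexO z (fun y => Th y g).
Lemma Up_goal_at (g : nat) : Up (goal_at g).
Proof.
  intros W z z' h1 h2; iex h2 y h; destruct h as [h2 h3]; apply (bexO_intro y); auto.
  app (h1 y); exact h2.
Qed.
Lemma D1_goal_at (g : nat) : D1 (goal_at g).
Proof.
  intros k t [i Hi]; assert (H : definable true k (fun r => goal_at g (r i))) by (unfold goal_at; dd).
  destruct H as (A & HA & E); exists A; split; auto; intros r H; rewrite Hi; auto.
Qed.

(** * The nucleus and its interaction with codes *)

Definition Mono (phi : nat -> Omega) : Prop :=
  forall W p q, W ||- subO p q -> W ||- phi p -> W ||- phi q.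
Definition JC (phi : nat -> Omega) : Prop := forall W p, W ||- J phi p -> W ||- phi p.

Lemma J_mono (phi : nat -> Omega) : Mono (J phi).
Proof.
  intros W p q H1 H2 g r; ii hr; ii K; apply (impO_app _ _ _ (impO_app _ _ _ (H2 g r) (subO_trans _ _ _ _ H1 hr)) K).
Qed.
Lemma J_unit (phi : nat -> Omega) (p : nat) (W : list form) : Mono phi -> W ||- phi p -> W ||- J phi p.
Proof.
  intros M H g q; ii hq; ii K; apply (impO_app _ _ _ (impO_app _ _ _ (K q) (subO_refl q _))).
  apply (M _ p); auto.
Qed.
Lemma J_map (phi psi : nat -> Omega) (p : nat) (W : list form) : W ||- J phi p ->
  (forall W' q, incl W W' -> W' ||- subO p q -> W' ||- phi q -> W' ||- psi q) -> W ||- J psi p.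
Proof.
  intros H L g q; ii hq; ii K; apply (impO_app _ _ _ (impO_app _ _ _ (H g q) hq)).
  ib r hr; ii hp; apply (impO_app _ _ _ (impO_app _ _ _ (K r) hr)).
  apply L; auto; apply (subO_trans _ q); auto.
Qed.
Lemma J_elim (phi psi : nat -> Omega) (p : nat) (W : list form) : JC psi -> W ||- J phi p ->
  (forall W' q, incl W W' -> W' ||- subO p q -> W' ||- phi q -> W' ||- psi q) -> W ||- psi p.
Proof. intros C H L; apply C, (J_map phi); auto. Qed.
Lemma JC_J (phi : nat -> Omega) : JC (J phi).
Proof.
  intros W p H g q; ii hq; ii K; apply (impO_app _ _ _ (impO_app _ _ _ (H g q) hq)).
  ib r hr; ii hp; apply (impO_app _ _ _ (impO_app _ _ _ (hp g r) (subO_refl r _))).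
  ib s hs; ii hf; apply (impO_app _ _ _ (impO_app _ _ _ (K s) (subO_trans _ _ _ _ hr hs)) hf).
Qed.

(** A Delta0 proposition that is merely established may be used as if true when proving a
    [J]-statement, because such a statement only promises goals, and goals are established
    statements to which [est_cut] applies. *)
Lemma J_cut (phi : nat -> Omega) (P : Omega) (p : nat) (W : list form) : D0 P -> Mono phi ->
  W ||- est p (fun _ => P) -> W ||- impO P (phi p) -> W ||- J phi p.
Proof.
  intros DP M H1 H2 g q; ii hq; ii K; apply (est_cut q P (goal_at g)); auto using D1_goal_at, Up_goal_at.
  - eapply est_le; eauto.
  - ii k; apply (impO_app _ _ _ (impO_app _ _ _ (K q) (subO_refl q _))).
    apply (M _ p); auto; app H2; exact k.
Qed.

(** One kind of code has two roles: for a Pi formula, [c] is put into conditions as an assumption;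
    for a Sigma formula, [c] is the parameter of a goal. *)
Definition coded (A : form) : Prop :=
  forall r W, W ||- exO (fun c => allO (fun x => iffO (Th x c) (rel x r A))).

Lemma Up_rel (r : nat -> nat) (A : form) : polar true A -> Up (fun z => rel z r A).
Proof. intros S W z z'; apply rel_up, S. Qed.

(** The goal coded by [A] is equivalent to establishing [A]. A bound [z] for [A] becomes an element
    of a larger bound, where the search of the goal finds it; conversely a [y] found in [z] is a
    subset of the union of [z], so [A] moves up from [y] to a bound containing that union. *)
Lemma J_use (phi : nat -> Omega) (p : nat) (r : nat -> nat) (A : form) (W : list form) :
  coded A -> polar true A -> W ||- J phi p ->
  (forall W' q, incl W W' -> W' ||- subO p q -> W' ||- phi q -> W' ||- est q (fun z => rel z r A)) ->
  W ||- est p (fun z => rel z r A).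
Proof.
  intros C S H K; specialize (C r W); iex C c hcoded.
  assert (G : V ||- goal p c).
  { apply (impO_app _ _ _ (impO_app _ _ _ (H c p) (subO_refl p _))); ib q hq; ii hp.
    apply K in hp; auto.
    apply (est_enlarge _ _ _ _ hp); intros W' z I'.
    pushI I'; wp L (fun W => insert_weak z z W); iex L z' h'; destruct h' as [h1 h2].
    apply (exO_intro z'); split; auto; ii h; apply (bexO_intro z); auto.
    destruct (hcoded z) as [_ k]; app k; exact h. }
  apply (est_enlarge _ _ _ _ G); intros W' z I'; pushI I'.
  wp L (fun W => union_weak W z); iex L u hu; wp L (fun W => cup_weak z u W); iex L z' h'; destruct h' as [h1 h2].
  apply (exO_intro z'); split; auto; ii h; iex h y hy; destruct hy as [h3 h4].
  apply (rel_up A r y); auto.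
  - apply (subO_trans _ u); auto; app (hu y); exact h3.
  - destruct (hcoded y) as [k _]; app k; exact h4.
Qed.

(* Discharging a condition: if every extension of [q] forcing the Pi formula
   [C] establishes [R], then [q] establishes [C -> R]. *)
Lemma discharge (q : nat) (r : nat -> nat) (C : form) (R : nat -> Omega) (W : list form) :
  coded C -> polar false C -> Up R ->
  (forall W' s, incl W W' -> W' ||- subO q s ->
    W' ||- allO (fun z => est s (fun _ => rel z r C)) -> W' ||- est s R) ->
  W ||- est q (fun z => impO (rel z r C) (R z)).
Proof.
  intros CC S U K; specialize (CC r W); iex CC c hcoded.
  wp L (fun W => insert_weak c q W); iex L b hb; destruct hb as [hb1 hb2].
  wa L (exO (fun s => allO (fun a => iffO (memO a s) (andO (memO a b) (orO (memO a q) (eqO a c)))))).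
  { apply (separation _ (fun a => orO (memO a q) (eqO a c))); dd. }
  iex L s hs; assert (E : V ||- est s R).
  { apply K; auto.
    - ib a ha; destruct (hs a) as [_ k]; app k; split; [app (hb2 a); exact ha|apply orO_l, ha].
    (* [star s z'] yields [C] relativized to the elements of [z'], so [z] is made one of them. *)
    - intros z; wp L (fun W => insert_weak z z W); iex L z' h'; destruct h' as [h1 h2].
      apply (exO_intro z'); ii h; destruct (hcoded z) as [k _]; app k.
      wa hcs (memO c s).
      { destruct (hs c) as [_ l]; app l; split; [exact hb1|apply orO_r, eqO_refl]. }
      apply (ballO_app _ _ _ _ (ballO_app _ _ _ _ h hcs) h1). }
  (* [z'] contains the union of [z], so every element [x] of [z] is a subset of [z'] and the Pi
     formula [C] goes down from [z'] to [x]. This recovers the part of [star s z] that concerns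
     [c]. *)
  iex E z hz; wp L (fun W => union_weak W z); iex L u hu; wp L (fun W => cup_weak z u W); iex L z' h'; destruct h' as [h1 h2].
  apply (exO_intro z'); ii h; ii h'; apply (U _ z); auto; app hz; ib a ha.
  destruct (hs a) as [k _]; apply (fun k => impO_app _ _ _ k ha) in k; destruct k as [_ k].
  ior k k.
  - ib x hx; app (ballO_app _ _ _ _ h k x); app (h1 x); exact hx.
  - ib x hx; apply (eqO_subst _ (Th x) c a); [dd|apply eqO_sym, k|].
    destruct (hcoded x) as [_ l]; app l; apply (rel_down C r x z'); auto.
    apply (subO_trans _ u); auto; app (hu x); exact hx.
Qed.

(** * The forcing interpretation *)

Definition fallO (I P : nat -> nat -> Omega) (p : nat) : Omega :=
  allO (fun x => allO (fun q => impO (subO p q) (impO (I q x) (P q x)))).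
Definition fexO (I P : nat -> nat -> Omega) (p : nat) : Omega :=
  J (fun q => exO (fun x => andO (I q x) (P q x))) p.
Definition fmem (q x y : nat) : Omega := J (fun _ => memO x y) q.

(* [F q f a b] stands for the forcing interpretation of [funf f a b], which is
   not a subformula of [EAll a b B]. *)
Fixpoint forceF (F : nat -> nat -> nat -> nat -> Omega) (p : nat) (r : nat -> nat) (A : form) : Omega :=
  match A with
  | Mem x y => fmem p (r x) (r y)
  | Bot => J (fun _ => botO) p
  | And B C => andO (forceF F p r B) (forceF F p r C)
  | Or B C => J (fun q => orO (forceF F q r B) (forceF F q r C)) p
  | Imp B C => allO (fun q => impO (subO p q) (impO (forceF F q r B) (forceF F q r C)))
  | All B => allO (fun x => forceF F p (scons x r) B)
  | Ex B => J (fun q => exO (fun x => forceF F q (scons x r) B)) p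
  | BAll y B => fallO (fun q x => fmem q x (r y)) (fun q x => forceF F q (scons x r) B) p
  | BEx y B => fexO (fun q x => fmem q x (r y)) (fun q x => forceF F q (scons x r) B) p
  | EAll a b B => fallO (fun q f => F q f (r a) (r b)) (fun q x => forceF F q (scons x r) B) p
  | EEx a b B => fexO (fun q f => F q f (r a) (r b)) (fun q x => forceF F q (scons x r) B) p
  end.

Lemma forceF_rename (F : nat -> nat -> nat -> nat -> Omega) (A : form) : forall p r s,
  forceF F p r (rename s A) = forceF F p (fun n => r (s n)) A.
Proof.
  assert (E : forall x r s, (fun n => scons x r (up s n)) = scons x (fun n => r (s n)))
    by (intros; apply functional_extensionality; intros [|n]; reflexivity).
  induction A; intros p r s; cbn; rewrite ?IHA1, ?IHA2; auto; unfold fallO, fexO; repeat (f_equal; fx);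
    rewrite ?IHA, ?E, ?IHA1, ?IHA2; reflexivity.
Qed.

Definition MonoF (F : nat -> nat -> nat -> nat -> Omega) : Prop :=
  forall f a b, Mono (fun q => F q f a b).

Lemma Mono_fallO (I P : nat -> nat -> Omega) : Mono (fallO I P).
Proof.
  intros W p q H1 H2 x s; ii hs; exact (impO_app _ _ _ (H2 x s) (subO_trans _ _ _ _ H1 hs)).
Qed.

Lemma Mono_forceF (F : nat -> nat -> nat -> nat -> Omega) (A : form) :
  forall r, Mono (fun p => forceF F p r A).
Proof.
  induction A; intros r; cbn [forceF].
  1: exact (J_mono (fun _ => memO (r n) (r n0))).
  1: exact (J_mono (fun _ => botO)).
  2: exact (J_mono (fun q => orO (forceF F q r A1) (forceF F q r A2))).
  4: exact (J_mono (fun q => exO (fun x => forceF F q (scons x r) A))).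
  4, 6: apply Mono_fallO.
  4, 5: apply J_mono.
  - intros W p q H [H1 H2]; split; [apply (IHA1 r W p q)|apply (IHA2 r W p q)]; auto.
  - intros W p q H1 H2 s; ii hs; exact (impO_app _ _ _ (H2 s) (subO_trans _ _ _ _ H1 hs)).
  - intros W p q H1 H2 x; apply (IHA (scons x r) W p q H1), H2.
Qed.

Lemma JC_fallO (I P : nat -> nat -> Omega) : (forall x, Mono (fun q => I q x)) ->
  (forall x, JC (fun q => P q x)) -> JC (fallO I P).
Proof.
  intros M C W p H x q; ii hq; ii hi; apply (C x), (J_map (fallO I P)).
  - apply (J_mono _ _ p); auto.
  - intros W' s I' hs hf; pushI I'; apply (impO_app _ _ _ (impO_app _ _ _ (hf x s) (subO_refl s _))).
    apply (M x _ q); auto.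
Qed.

Lemma JC_forceF (F : nat -> nat -> nat -> nat -> Omega) (A : form) : MonoF F ->
  forall r, JC (fun p => forceF F p r A).
Proof.
  intros MF; induction A; intros r; cbn [forceF].
  1: exact (JC_J (fun _ => memO (r n) (r n0))).
  1: exact (JC_J (fun _ => botO)).
  2: exact (JC_J (fun q => orO (forceF F q r A1) (forceF F q r A2))).
  4: exact (JC_J (fun q => exO (fun x => forceF F q (scons x r) A))).
  5, 7: apply JC_J.
  - intros W p H; split; [apply (IHA1 r)|apply (IHA2 r)]; apply (J_map _ _ _ _ H);
      intros W' q _ _ h; apply h.
  - intros W p H q; ii hq; ii hi; apply (IHA2 r), (J_map (fun p => forceF F p r (Imp A1 A2))).
    + apply (J_mono _ _ p); auto.
    + intros W' s I' hs hf; pushI I'; apply (impO_app _ _ _ (impO_app _ _ _ (hf s) (subO_refl s _))).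
      apply (Mono_forceF F A1 r _ q); auto.
  - intros W p H x; apply (IHA (scons x r)), (J_map _ _ _ _ H); intros W' q _ _ h; apply h.
  - apply JC_fallO; auto; intros x; apply J_mono.
  - apply JC_fallO; auto.
Qed.

(** * Comparing forced and established formulas *)

Fixpoint hcoded (A : form) : Prop :=
  coded A /\ match A with
  | Mem _ _ | Bot => True
  | And B C | Or B C | Imp B C => hcoded B /\ hcoded C
  | All B | Ex B | BAll _ B | BEx _ B | EAll _ _ B | EEx _ _ B => hcoded B
  end.

(** On these formulas [forceF] never consults [F]. As [funf] is one of them, its forcing can be
    defined with a dummy [F] and then used to interpret the exponentiation-bounded quantifiers,
    without circularity. *)
Fixpoint efree (A : form) : Prop :=
  match A with
  | Mem _ _ | Bot => True
  | And B C | Or B C | Imp B C => efree B /\ efree C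
  | All B | Ex B | BAll _ B | BEx _ B => efree B
  | EAll _ _ _ | EEx _ _ _ => False
  end.

(** The guard of a bounded quantifier is Delta0, hence both Sigma and Pi, so forcing it and
    establishing it can be expected to agree. *)
Definition atom_spec (FI : nat -> nat -> Omega) (I : nat -> Omega) : Prop :=
  forall W p x, W ||- FI p x <-> W ||- est p (fun _ => I x).

Lemma ball_a (FI : nat -> nat -> Omega) (I : nat -> Omega) (P : nat -> nat -> Omega) (R : nat -> nat -> Omega)
  (p : nat) (W : list form) : atom_spec FI I -> D1 I -> Bd I -> D2 R -> (forall x, Up (R x)) ->
  W ||- fallO FI P p ->
  (forall W' x, incl W W' -> W' ||- P p x -> W' ||- est p (R x)) ->
  W ||- est p (fun z => allO (fun x => impO (I x) (R x z))).
Proof.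
  intros S DI BI DR U H K; apply est_coll; auto; ib x hx; apply K; auto.
  apply (impO_app _ _ _ (impO_app _ _ _ (H x p) (subO_refl p _))).
  apply S, (est_true p (fun _ => I x) 0), hx.
Qed.

Lemma ball_b (FI : nat -> nat -> Omega) (I : nat -> Omega) (P : nat -> nat -> Omega) (Q : nat -> nat -> Omega)
  (p : nat) (W : list form) : atom_spec FI I ->
  W ||- allO (fun z => est p (fun _ => allO (fun x => impO (I x) (Q x z)))) ->
  (forall W' q x, incl W W' -> W' ||- subO p q ->
    W' ||- allO (fun z => est q (fun _ => Q x z)) -> W' ||- P q x) ->
  W ||- fallO FI P p.
Proof.
  intros S H K x q; ii hq; ii hi; apply K; auto; intros z; apply S in hi.
  pose proof (est_le _ _ _ _ hq (H z)) as h.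
  apply (est_and _ _ _ _ _ (Up_const _) (Up_const _) hi h).
  intros W' _ I' h1 h2; app (h2 x); exact h1.
Qed.

Lemma D2_rel (r : nat -> nat) (A : form) : D2 (fun x z => rel z (scons x r) A).
Proof. intros k s t Hs Ht; apply definable_rel; auto; apply env_def_scons; auto using env_def_const. Qed.

(** The [x] for which [B] holds may depend on [z], so no witness can be forced outright. Against a
    fixed goal, [B] is discharged for each [x] separately; collection over the bounded guard gives
    one [z] at which every instance of [B] yields the goal, and the established existential is used
    at this [z] only. *)
Lemma bex_b (FI : nat -> nat -> Omega) (I : nat -> Omega) (P : nat -> nat -> Omega) (r : nat -> nat)
  (B : form) (p : nat) (W : list form) :
  atom_spec FI I -> D1 I -> Bd I -> coded B -> polar false B ->
  W ||- allO (fun z => est p (fun _ => exO (fun x => andO (I x) (rel z (scons x r) B)))) ->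
  (forall W' q x, incl W W' -> W' ||- subO p q ->
    W' ||- allO (fun z => est q (fun _ => rel z (scons x r) B)) -> W' ||- P q x) ->
  W ||- fexO FI P p.
Proof.
  intros S DI BI C SB H K g q; ii hq; ii L.
  assert (UR : forall x, Up (fun z => impO (rel z (scons x r) B) (goal_at g z))).
  { intros x W' z z' h1 h2; ii h; apply (Up_goal_at g _ z); auto; app h2.
    apply (rel_down B _ z z'); auto. }
  apply (est_join q (fun z => allO (fun x => impO (I x) (impO (rel z (scons x r) B) (goal_at g z))))
    (fun z => exO (fun x => andO (I x) (rel z (scons x r) B)))).
  - intros W' z z' h1 h2; ib x hx; apply (UR x _ z); auto; app (h2 x); exact hx.
  - apply Up_goal_at.
  - apply (est_coll q I (fun x z => impO (rel z (scons x r) B) (goal_at g z))); auto.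
    + intros k s t Hs Ht; apply definable_imp; [apply D2_rel; auto|apply D1_goal_at; auto].
    + ib x hx; apply discharge; auto using Up_goal_at; intros W' s I' hs h; pushI I'.
      apply (impO_app _ _ _ (impO_app _ _ _ (L s) hs)), (exO_intro x); split.
      * apply S, (est_true s (fun _ => I x) 0), hx.
      * apply K; auto; apply (subO_trans _ q); auto.
  - intros z; apply (est_le p); auto.
  - intros W' z I' h1 h2; iex h2 x h; destruct h as [h2 h3].
    apply (impO_app _ _ _ (impO_app _ _ _ (h1 x) h2)), h3.
Qed.

Lemma Bd_mem (y : nat) : Bd (fun x => memO x y).
Proof. intros W; apply (exO_intro y); ib x h; exact h. Qed.
Lemma Bd_fun (a b : nat) : Bd (fun f => funO f a b).
Proof. intros W; apply exp_weak. Qed.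
Lemma D1_mem (y : nat) : D1 (fun x => memO x y).
Proof. intros k t Ht; apply definable_mem; [exact Ht|tm]. Qed.
Lemma D1_fun (a b : nat) : D1 (fun x => funO x a b).
Proof. intros k t Ht; apply definable_fun; [exact Ht|tm|tm]. Qed.

Hypothesis coded_mem : coded (Mem 0 1).

Lemma Mono_const (P : Omega) : Mono (fun _ => P).
Proof. intros W p q _ h; exact h. Qed.

Lemma atom_spec_mem (y : nat) : atom_spec (fun q x => fmem q x y) (fun x => memO x y).
Proof.
  intros W p x; split; intros H.
  - apply (J_use _ p (scons x (scons y (fun n => n))) (Mem 0 1) _ coded_mem I H).
    intros W' q _ _ h; apply (est_true _ _ 0), h.
  - apply (J_cut _ (memO x y)); auto using Mono_const.
    + intros k; apply definable_mem; tm.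
    + ii h; exact h.
Qed.

Definition fun_spec (F : nat -> nat -> nat -> nat -> Omega) : Prop :=
  forall a b, atom_spec (fun q f => F q f a b) (fun f => funO f a b).

Definition sound_for (F : nat -> nat -> nat -> nat -> Omega) (A : form) (b : bool) : Prop :=
  forall W p r, if b
    then W ||- forceF F p r A -> W ||- est p (fun z => rel z r A)
    else W ||- allO (fun z => est p (fun _ => rel z r A)) -> W ||- forceF F p r A.


Lemma sound_t (F : nat -> nat -> nat -> nat -> Omega) (A : form) (p : nat) (r : nat -> nat)
  (W : list form) : sound_for F A true ->
  W ||- forceF F p r A -> W ||- est p (fun z => rel z r A).
Proof. intros H; apply H. Qed.

Lemma sound_f (F : nat -> nat -> nat -> nat -> Omega) (A : form) (p : nat) (r : nat -> nat)
  (W : list form) : sound_for F A false ->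
  W ||- allO (fun z => est p (fun _ => rel z r A)) -> W ||- forceF F p r A.
Proof. intros H; apply H. Qed.

Lemma forceF_key (F : nat -> nat -> nat -> nat -> Omega) (A : form) : efree A \/ fun_spec F -> hcoded A ->
  forall b, polar b A -> sound_for F A b.
Proof.
  intros HF HC.
  induction A; cbn in HC, HF; intros b S; cbn in S; destruct b; intros W p r H.
  - exact (proj1 (atom_spec_mem (r n0) W p (r n)) H).
  - exact (proj2 (atom_spec_mem (r n0) W p (r n)) (H 0)).
  - apply (J_use _ p r Bot _ (proj1 HC) I H); intros W' q _ _ h; apply botO_elim, h.
  - pose proof (H 0) as H'; apply (J_cut _ botO); auto using Mono_const.
    + intros k; apply definable_bot.
    + ii h; exact h.
  - destruct S as [S1 S2], HC as (_ & C1 & C2), H as [H1 H2].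
    apply (sound_t _ _ _ _ _ (IHA1 ltac:(tauto) C1 true S1)) in H1.
    apply (sound_t _ _ _ _ _ (IHA2 ltac:(tauto) C2 true S2)) in H2.
    apply (est_and _ _ _ _ _ (Up_rel r A1 S1) (Up_rel r A2 S2) H1 H2); intros W' z _ h1 h2; split; auto.
  - destruct S as [S1 S2], HC as (_ & C1 & C2).
    split; [apply (sound_f _ _ _ _ _ (IHA1 ltac:(tauto) C1 false S1))|apply (sound_f _ _ _ _ _ (IHA2 ltac:(tauto) C2 false S2))];
      intros z; apply (est_imp _ _ _ _ (H z)); intros W' _ _ h; apply h.
  - destruct S as [S1 S2], HC as (C & C1 & C2).
    apply (J_use _ p r (Or A1 A2) _ C (conj S1 S2) H); intros W' q _ _ h; ior h h.
    + apply (sound_t _ _ _ _ _ (IHA1 ltac:(tauto) C1 true S1)) in h; apply (est_imp _ _ _ _ h); intros; apply orO_l; auto.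
    + apply (sound_t _ _ _ _ _ (IHA2 ltac:(tauto) C2 true S2)) in h; apply (est_imp _ _ _ _ h); intros; apply orO_r; auto.
  - destruct S as [S1 S2], HC as (C & C1 & C2).
    (* The disjunct that holds may vary with [z]. As for bounded existentials, each disjunct is
       discharged against the goal, and the disjunction is consulted at the common bound. *)
    intros g q; ii hq; ii K.
    assert (U : forall B, polar false B -> Up (fun z => impO (rel z r B) (goal_at g z))).
    { intros B SB W' z z' h1 h2; ii h; apply (Up_goal_at g _ z); auto; app h2.
      apply (rel_down B r z z'); auto. }
    assert (C1' : coded A1) by (destruct A1; apply C1).
    assert (C2' : coded A2) by (destruct A2; apply C2).
    wa L1 (est q (fun z => impO (rel z r A1) (goal_at g z))).
    { apply discharge; auto using Up_goal_at; intros W' s I' hs h; pushI I'.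
      apply (impO_app _ _ _ (impO_app _ _ _ (K s) hs)), orO_l.
      apply (sound_f _ _ _ _ _ (IHA1 ltac:(tauto) C1 false S1)); auto. }
    wa L2 (est q (fun z => impO (rel z r A2) (goal_at g z))).
    { apply discharge; auto using Up_goal_at; intros W' s I' hs h; pushI I'.
      apply (impO_app _ _ _ (impO_app _ _ _ (K s) hs)), orO_r.
      apply (sound_f _ _ _ _ _ (IHA2 ltac:(tauto) C2 false S2)); auto. }
    apply (est_join q (fun z => andO (impO (rel z r A1) (goal_at g z)) (impO (rel z r A2) (goal_at g z)))
      (fun z => orO (rel z r A1) (rel z r A2))).
    + intros W' z z' h1 [h2 h3]; split; [apply (U A1 S1 _ z)|apply (U A2 S2 _ z)]; auto.
    + apply Up_goal_at.
    + apply (est_and _ _ _ _ _ (U A1 S1) (U A2 S2) L1 L2); intros; split; auto.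
    + intros z; apply (est_le p); auto; apply H.
    + intros W' z I' [h1 h2] h; ior h h; [app h1|app h2]; exact h.
  - destruct S as [S1 S2], HC as (C & C1 & C2).
    assert (C1' : coded A1) by (destruct A1; apply C1).
    apply (discharge p r A1 (fun z => rel z r A2)); auto using Up_rel.
    intros W' s I' hs h; pushI I'; apply (sound_t _ _ _ _ _ (IHA2 ltac:(tauto) C2 true S2)).
    apply (impO_app _ _ _ (impO_app _ _ _ (H s) hs)), (sound_f _ _ _ _ _ (IHA1 ltac:(tauto) C1 false S1)), h.
  - destruct S as [S1 S2], HC as (C & C1 & C2).
    intros q; ii hq; ii h; apply (sound_f _ _ _ _ _ (IHA2 ltac:(tauto) C2 false S2)); intros z.
    apply (sound_t _ _ _ _ _ (IHA1 ltac:(tauto) C1 true S1)) in h; iex h z0 h0.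
    (* The implication is used at [z1], above both the bound [z] asked for and the bound [z0] of the
       premise: the Sigma premise goes up from [z0] to [z1], the Pi conclusion down from [z1] to
       [z]. *)
    wp L (fun W => cup_weak z z0 W); iex L z1 h1; destruct h1 as [h1 h2].
    pose proof (H z1) as H1; iex H1 z2 h3.
    wp L (fun W => cup_weak z0 z2 W); iex L z3 h4; destruct h4 as [h4 h5].
    apply (exO_intro z3); ii k; apply (rel_down A2 r z z1); auto.
    apply (fun a b => impO_app _ _ _ (impO_app _ _ _ h3 a) b).
    + apply (star_le p q); auto; apply (star_anti q z2 z3); auto.
    + apply (rel_up A1 r z0 z1); auto; app h0; apply (star_anti q z0 z3); auto.
  - destruct S; discriminate.
  - destruct S as [_ S], HC as [_ C]; intros x; apply (sound_f _ _ _ _ _ (IHA ltac:(tauto) C false S)); intros z.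
    (* [x] need not belong to [z]. The hypothesis is used at a bound containing it, and the Pi
       formula then goes down to [z]. *)
    wp L (fun W => insert_weak x z W); iex L z1 h1; destruct h1 as [h1 h2].
    apply (est_imp _ _ _ _ (H z1)); intros W' _ I' h; pushI I'.
    apply (rel_down A _ z z1); auto; app (h x); exact h1.
  - destruct S as [_ S]; pose proof HC as [C' C].
    apply (J_use _ p r (Ex A) _ C' (conj eq_refl S) H); intros W' q I' hq h; iex h x h.
    apply (sound_t _ _ _ _ _ (IHA ltac:(tauto) C true S)) in h; apply (est_enlarge _ _ _ _ h); intros W'' z I''; pushI I''.
    wp L (fun W => insert_weak x z W); iex L z1 h1; destruct h1 as [h1 h2].
    apply (exO_intro z1); split; auto; ii k; apply (exO_intro x); split; auto.
    apply (rel_up A _ z z1); auto.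
  - destruct S; discriminate.
  - destruct HC as [C' C]; apply (ball_a _ _ (fun q x => forceF F q (scons x r) A) (fun x z => rel z (scons x r) A) _ _
      (atom_spec_mem (r n)) (D1_mem _) (Bd_mem _)); auto using D2_rel, Up_rel.
    intros W' x _; apply (sound_t _ _ _ _ _ (IHA ltac:(tauto) C true S)).
  - destruct HC as [C' C]; apply (ball_b _ _ (fun q x => forceF F q (scons x r) A) (fun x z => rel z (scons x r) A) _ _
      (atom_spec_mem (r n))); [exact H|].
    intros W' q x _ _; apply (sound_f _ _ _ _ _ (IHA ltac:(tauto) C false S)).
  - pose proof HC as [C' C]; apply (J_use _ p r (BEx n A) _ C' S H); intros W' q I' hq h; iex h x h.
    destruct h as [h1 h2]; apply atom_spec_mem in h1; apply (sound_t _ _ _ _ _ (IHA ltac:(tauto) C true S)) in h2.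
    apply (est_and _ _ _ _ _ (Up_const _) (Up_rel _ _ S) h1 h2).
    intros W'' z _ k1 k2; apply (exO_intro x); split; auto.
  - destruct HC as [C' C]; assert (C1 : coded A) by (destruct A; apply C).
    apply (bex_b _ _ (fun q x => forceF F q (scons x r) A) r A _ _ (atom_spec_mem (r n)) (D1_mem _) (Bd_mem _)); auto.
    intros W' q x _ _; apply (sound_f _ _ _ _ _ (IHA ltac:(tauto) C false S)).
  - destruct HC as [C' C], HF as [[]|HF]; apply (ball_a _ _ (fun q x => forceF F q (scons x r) A) (fun x z => rel z (scons x r) A) _ _
      (HF (r n) (r n0)) (D1_fun _ _) (Bd_fun _ _)); auto using D2_rel, Up_rel.
    intros W' x _; apply (sound_t _ _ _ _ _ (IHA ltac:(tauto) C true S)).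
  - destruct HC as [C' C], HF as [[]|HF]; apply (ball_b _ _ (fun q x => forceF F q (scons x r) A) (fun x z => rel z (scons x r) A) _ _
      (HF (r n) (r n0))); [exact H|].
    intros W' q x _ _; apply (sound_f _ _ _ _ _ (IHA ltac:(tauto) C false S)).
  - pose proof HC as [C' C]; destruct HF as [[]|HF].
    apply (J_use _ p r (EEx n n0 A) _ C' S H); intros W' q I' hq h; iex h x h.
    destruct h as [h1 h2]; apply HF in h1; apply (sound_t _ _ _ _ _ (IHA ltac:(tauto) C true S)) in h2.
    apply (est_and _ _ _ _ _ (Up_const _) (Up_rel _ _ S) h1 h2).
    intros W'' z _ k1 k2; apply (exO_intro x); split; auto.
  - destruct HC as [C' C], HF as [[]|HF]; assert (C1 : coded A) by (destruct A; apply C).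
    apply (bex_b _ _ (fun q x => forceF F q (scons x r) A) r A _ _ (HF (r n) (r n0)) (D1_fun _ _) (Bd_fun _ _)); auto.
    intros W' q x _ _; apply (sound_f _ _ _ _ _ (IHA ltac:(tauto) C false S)).
Qed.

Definition force_fun (q f a b : nat) : Omega :=
  forceF (fun _ _ _ _ => botO) q (scons f (scons a (scons b (fun n => n)))) (funf 0 1 2).
Definition force : nat -> (nat -> nat) -> form -> Omega := forceF force_fun.

Hypothesis hcoded_funf : hcoded (funf 0 1 2).

Lemma MonoF_force_fun : MonoF force_fun.
Proof. intros f a b; exact (Mono_forceF _ _ _). Qed.

Lemma Delta0E_funf (f a b : nat) : Delta0E (funf f a b).
Proof. repeat constructor. Qed.

Lemma fun_spec_force_fun : fun_spec force_fun.
Proof.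
  assert (E : efree (funf 0 1 2)) by (cbn; tauto).
  intros a b W p x; set (r := scons x (scons a (scons b (fun n => n)))).
  assert (K : forall z, rel z r (funf 0 1 2) = funO x a b)
    by (intros z; unfold rel; rewrite relD_Delta0E by apply Delta0E_funf; symmetry; apply funO_ev).
  change (force_fun p x a b) with (forceF (fun _ _ _ _ => botO) p r (funf 0 1 2)); clearbody r.
  split; intros H.
  - apply (sound_t _ _ p r _ (forceF_key _ _ (or_introl E) hcoded_funf true (polar_Delta0E _ (Delta0E_funf 0 1 2) _)))
      in H.
    apply (est_imp _ _ _ _ H); intros W' z _ h; rewrite K in h; exact h.
  - apply (sound_f _ _ p r _ (forceF_key _ _ (or_introl E) hcoded_funf false (polar_Delta0E _ (Delta0E_funf 0 1 2) _))).
    intros z; rewrite K; exact H.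
Qed.

Lemma force_key (A : form) (b : bool) : hcoded A -> polar b A -> sound_for force_fun A b.
Proof. intros; apply forceF_key; auto using fun_spec_force_fun. Qed.

(** * Soundness of forcing for intuitionistic logic *)

Lemma force_mono (A : form) (r : nat -> nat) : Mono (fun p => force p r A).
Proof. apply Mono_forceF. Qed.
Lemma force_JC (A : form) (r : nat -> nat) : JC (fun p => force p r A).
Proof. apply JC_forceF, MonoF_force_fun. Qed.
Lemma force_rename (A : form) (p : nat) (r s : nat -> nat) :
  force p r (rename s A) = force p (fun n => r (s n)) A.
Proof. apply forceF_rename. Qed.
Lemma force_shift (A : form) (p x : nat) (r : nat -> nat) : force p (scons x r) (shift A) = force p r A.
Proof. unfold shift; rewrite force_rename; reflexivity. Qed.
Lemma force_inst (A : form) (p x : nat) (r : nat -> nat) :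
  force p r (inst x A) = force p (scons (r x) r) A.
Proof.
  unfold inst; rewrite force_rename; f_equal.
  apply functional_extensionality; intros [|n]; reflexivity.
Qed.
Lemma force_funf (p : nat) (r : nat -> nat) (f a b : nat) :
  force p r (funf f a b) = force_fun p (r f) (r a) (r b).
Proof. reflexivity. Qed.

Definition fctx (p : nat) (r : nat -> nat) (G : list form) (W : list form) : Prop :=
  forall B, In B G -> W ||- force p r B.

Lemma fctx_mono (p q : nat) (r : nat -> nat) (G W W' : list form) :
  fctx p r G W -> incl W W' -> W' ||- subO p q -> fctx q r G W'.
Proof.
  intros H I S B HB; apply (force_mono _ _ _ p); auto; eapply holds_mono; [exact I|auto].
Qed.
Lemma fctx_cons (p : nat) (r : nat -> nat) (A : form) (G W : list form) :
  W ||- force p r A -> fctx p r G W -> fctx p r (A :: G) W.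
Proof. intros H K B [<-|HB]; auto. Qed.
Lemma fctx_shift (p x : nat) (r : nat -> nat) (G W : list form) :
  fctx p r G W -> fctx p (scons x r) (map shift G) W.
Proof. intros H B (C & <- & HC)%in_map_iff; rewrite force_shift; auto. Qed.

Lemma force_sound (T : form -> Prop) (G : list form) (A : form) :
  (forall B, T B -> forall W p r, W ||- force p r B) -> prv T G A ->
  forall W p r, fctx p r G W -> W ||- force p r A.
Proof.
  intros HT D; induction D; intros W p r HG.
  - apply HT; auto.
  - apply HG; auto.
  - apply (J_elim (fun _ => botO) (fun q => force q r A) p _ (force_JC A r) (IHD W p r HG)).
    intros W' q _ _ h; apply botO_elim, h.
  - split; auto.
  - apply (IHD W p r HG).
  - apply (IHD W p r HG).
  - apply (J_unit (fun q => orO (force q r A) (force q r B))); [|apply orO_l, IHD, HG].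
    intros V s q hs h; ior h h; [apply orO_l|apply orO_r]; apply (force_mono _ _ _ s); auto.
  - apply (J_unit (fun q => orO (force q r A) (force q r B))); [|apply orO_r, IHD, HG].
    intros V s q hs h; ior h h; [apply orO_l|apply orO_r]; apply (force_mono _ _ _ s); auto.
  - apply (J_elim _ (fun q => force q r C) p _ (force_JC C r) (IHD1 W p r HG)).
    intros W' q I hq h; pose proof (fctx_mono _ _ _ _ _ _ HG I hq) as HG'.
    apply (orO_elim _ _ _ _ h); intros W'' I' h'; [apply IHD2|apply IHD3];
      (apply fctx_cons; [exact h'|apply (fctx_mono _ _ _ _ _ _ HG' I'), subO_refl]).
  - intros q W' I hq W'' I' h; apply IHD, fctx_cons; [exact h|].
    apply (fctx_mono _ q _ _ _ _ (fctx_mono _ _ _ _ _ _ HG I hq) I'), subO_refl.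
  - apply (impO_app _ _ _ (impO_app _ _ _ (IHD1 W p r HG p) (subO_refl p W))), IHD2, HG.
  - intros x; apply IHD, fctx_shift, HG.
  - rewrite force_inst; apply (IHD W p r HG).
  - apply (J_unit (fun q => exO (fun x => force q (scons x r) A))).
    + intros V s q hs h; iex h y h; apply (exO_intro y), (force_mono _ _ _ s); auto.
    + apply (exO_intro (r x)); rewrite <- force_inst; apply IHD, HG.
  - apply (J_elim _ (fun q => force q r C) p _ (force_JC C r) (IHD1 W p r HG)).
    intros W' q I hq h; pose proof (fctx_mono _ _ _ _ _ _ HG I hq) as HG'.
    apply (exO_elim _ _ _ h); intros x W'' I' h'.
    rewrite <- (force_shift C q x r); apply IHD2, fctx_cons; [exact h'|].
    apply fctx_shift, (fctx_mono _ _ _ _ _ _ HG' I'), subO_refl.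
  - intros x q W' I hq W'' I' h; apply IHD, fctx_cons; [exact h|].
    apply fctx_shift, (fctx_mono _ q _ _ _ _ (fctx_mono _ _ _ _ _ _ HG I hq) I'), subO_refl.
  - rewrite force_inst.
    apply (impO_app _ _ _ (impO_app _ _ _ (IHD1 W p r HG (r x) p) (subO_refl p W))), (IHD2 W p r HG).
  - apply (J_unit (fun q => exO (fun x => andO (fmem q x (r y)) (force q (scons x r) A)))).
    + intros V s q hs h; iex h z h; destruct h as [h1 h2]; apply (exO_intro z); split.
      * apply (J_mono _ _ s); auto.
      * apply (force_mono _ _ _ s); auto.
    + apply (exO_intro (r x)); split; [apply (IHD1 W p r HG)|rewrite <- force_inst; apply IHD2, HG].
  - apply (J_elim _ (fun q => force q r C) p _ (force_JC C r) (IHD1 W p r HG)).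
    intros W' q I hq h; pose proof (fctx_mono _ _ _ _ _ _ HG I hq) as HG'.
    apply (exO_elim _ _ _ h); intros x W'' I' [h1 h2].
    rewrite <- (force_shift C q x r); apply IHD2, fctx_cons; [exact h2|apply fctx_cons; [exact h1|]].
    apply fctx_shift, (fctx_mono _ _ _ _ _ _ HG' I'), subO_refl.
  - intros x q W' I hq W'' I' h; apply IHD, fctx_cons; [exact h|].
    apply fctx_shift, (fctx_mono _ q _ _ _ _ (fctx_mono _ _ _ _ _ _ HG I hq) I'), subO_refl.
  - rewrite force_inst.
    apply (impO_app _ _ _ (impO_app _ _ _ (IHD1 W p r HG (r x) p) (subO_refl p W))).
    rewrite <- force_funf; apply (IHD2 W p r HG).
  - change (force p r (EEx a b A)) with
      (J (fun q => exO (fun x => andO (force_fun q x (r a) (r b)) (force q (scons x r) A))) p).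
    apply J_unit.
    + intros V s q hs h; iex h z h; destruct h as [h1 h2]; apply (exO_intro z); split.
      * apply (MonoF_force_fun z (r a) (r b) _ s); auto.
      * apply (force_mono _ _ _ s); auto.
    + apply (exO_intro (r x)); split;
        [rewrite <- force_funf; apply (IHD1 W p r HG)|rewrite <- force_inst; apply IHD2, HG].
  - apply (J_elim _ (fun q => force q r C) p _ (force_JC C r) (IHD1 W p r HG)).
    intros W' q I hq h; pose proof (fctx_mono _ _ _ _ _ _ HG I hq) as HG'.
    apply (exO_elim _ _ _ h); intros x W'' I' [h1 h2].
    rewrite <- (force_shift C q x r); apply IHD2, fctx_cons; [exact h2|apply fctx_cons; [exact h1|]].
    apply fctx_shift, (fctx_mono _ _ _ _ _ _ HG' I'), subO_refl.
Qed.

(** * Forcing the axioms *)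

Lemma force_Delta0E (A : form) (p : nat) (r : nat -> nat) (W : list form) : Delta0E A -> hcoded A ->
  W ||- est p (fun _ => ev r A) -> W ||- force p r A.
Proof.
  intros D C H; apply (sound_f _ _ _ _ _ (force_key A false C (polar_Delta0E A D _))).
  intros z; unfold rel; rewrite relD_Delta0E by exact D; exact H.
Qed.

Inductive prenex : form -> Prop :=
| prenex_Delta0E A : Delta0E A -> prenex A
| prenex_All A : prenex A -> prenex (All A)
| prenex_Ex A : prenex A -> prenex (Ex A).

(** Forcing quantifies over the same domain as truth, so a true Delta0 matrix, established at any
    bound whatever, lifts through the prefix. This covers all axioms of IKP(E) except Collection and
    Set Induction. *)
Lemma force_prenex (A : form) : prenex A -> hcoded A -> forall W p r, W ||- ev r A -> W ||- force p r A.
Proof.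
  induction 1 as [A D|A H IH|A H IH]; intros C W p r HA.
  - apply force_Delta0E; auto; apply (est_true _ _ 0), HA.
  - intros x; apply IH; [apply C|apply HA].
  - apply (J_unit (fun q => exO (fun x => force q (scons x r) A))).
    + intros V s q hs h; iex h y h; apply (exO_intro y), (force_mono _ _ _ s); auto.
    + cbn in HA; iex HA x h; apply (exO_intro x), IH; [apply C|exact h].
Qed.

(** The bound [z] establishing [A] is itself the witness: [A^z] is a Delta0 statement that holds
    under [star q z], so the same [z] establishes it, and established Delta0 statements are
    forced. *)
Lemma force_reflection (A : form) (p : nat) (r : nat -> nat) (W : list form) : polar true A ->
  hcoded (Imp A (Ex (relz 0 (shift A)))) -> W ||- force p r (Imp A (Ex (relz 0 (shift A)))).
Proof.
  intros S (_ & C & C' & CR) q; ii hq; ii h.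
  apply (sound_t force_fun _ _ _ _ (force_key A true C S)) in h; iex h z h.
  apply (J_unit (fun q => exO (fun x => force q (scons x r) (relz 0 (shift A))))).
  - intros V1 s t hs k; iex k y k; apply (exO_intro y), (force_mono _ _ _ s); auto.
  - apply (exO_intro z), force_Delta0E; auto using Delta0E_relz.
    rewrite <- rel_ev; apply (exO_intro z); exact h.
Qed.

(** * Definability of forcing and Set Induction *)

Lemma definable_conv (b : bool) (k : nat) (P Q : (nat -> nat) -> Omega) :
  (forall r, tail_id k r -> P r = Q r) -> definable b k Q -> definable b k P.
Proof. intros E (A & HA & EA); exists A; split; auto; intros r H; rewrite E; auto. Qed.

Lemma definable_subst (b : bool) (k k' : nat) (s : nat -> nat) (P : (nat -> nat) -> Omega) :
  (forall r, tail_id k' r -> tail_id k (fun n => r (s n))) -> definable b k P ->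
  definable b k' (fun r => P (fun n => r (s n))).
Proof.
  intros Hs (A & HA & E); exists (rename s A); split; [intros; apply Delta0E_rename; auto|].
  intros r H; rewrite ev_rename; auto.
Qed.

Lemma definable_goal (k : nat) (s t : (nat -> nat) -> nat) :
  term_def k s -> term_def k t -> definable false k (fun r => goal (s r) (t r)).
Proof.
  intros [i Hi] [j Hj].
  assert (H : definable false k (fun r => goal (r i) (r j))).
  { unfold goal, est; apply definable_ex, definable_imp; [apply definable_star; tm|dd]. }
  destruct H as (A & HA & E); exists A; split; auto; intros r H; rewrite Hi, Hj; auto.
Qed.

Lemma definable_J (k i : nat) (phi : nat -> (nat -> nat) -> Omega) :
  definable false (S k) (fun r => phi (r 0) (fun n => r (S n))) ->
  definable false k (fun r => J (fun q => phi q r) (r i)).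
Proof.
  intros H; unfold J.
  apply (definable_all k (fun g r => _)), (definable_all (S k) (fun q r => _)), definable_imp; [dd|].
  apply definable_imp; [|apply definable_goal; tm].
  apply definable_all, definable_imp; [dd|]; apply definable_imp; [|apply definable_goal; tm].
  refine (definable_subst false (S k) _ (scons 0 (fun n => S (S (S n)))) _ _ H).
  intros r Hr n; apply Hr.
Qed.

(** Forcing is not bounded, since [J] and implication range over all larger conditions, but for each
    fixed [A] it is a formula, and Set Induction is available for all formulas. *)
Lemma definable_forceF (F : nat -> nat -> nat -> nat -> Omega) (A : form) :
  efree A \/ (forall k q f a b, definable false k (fun r => F (r q) (r f) (r a) (r b))) ->
  forall k i s, definable false k (fun r => forceF F (r i) (fun n => r (s n)) A).
Proof.
  intros HF.
  assert (Hm : forall k q x y, definable false k (fun r => fmem (r q) (r x) (r y)))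
    by (intros k q x y; apply (definable_J k q (fun _ r => memO (r x) (r y))); dd).
  induction A; intros k i s; cbn [forceF].
  1: apply Hm.
  1: apply (definable_J k i (fun _ _ => botO)); dd.
  1: apply definable_and; [apply IHA1|apply IHA2]; cbn in HF; tauto.
  1: { apply (definable_J k i (fun q r => orO (forceF F q (fun n => r (s n)) A1) (forceF F q (fun n => r (s n)) A2))).
    apply definable_or; [apply (fun H => IHA1 H (S k) 0 (fun n => S (s n)))
      |apply (fun H => IHA2 H (S k) 0 (fun n => S (s n)))]; cbn in HF; tauto. }
  1: { apply definable_all, definable_imp; [dd|apply definable_imp;
      [apply (fun H => IHA1 H (S k) 0 (fun n => S (s n)))
      |apply (fun H => IHA2 H (S k) 0 (fun n => S (s n)))]; cbn in HF; tauto]. }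
  all: assert (IH : forall k i j s, definable false k (fun r => forceF F (r i) (scons (r j) (fun n => r (s n))) A))
    by (intros k1 i1 j1 s1; apply (definable_conv _ _ _ (fun r => forceF F (r i1) (fun n => r (scons j1 s1 n)) A));
      [intros r _; f_equal; apply functional_extensionality; intros [|m]; reflexivity
      |apply IHA; cbn in HF; tauto]).
  1: apply definable_all; apply (IH (S k) (S i) 0 (fun n => S (s n))).
  1: apply (definable_J k i (fun q r => exO (fun x => forceF F q (scons x (fun n => r (s n))) A)));
     apply definable_ex; apply (IH (S (S k)) 1 0 (fun n => S (S (s n)))).
  1, 3: unfold fallO; apply definable_all, definable_all, definable_imp; [dd|apply definable_imp;
     [|apply (IH (S (S k)) 0 1 (fun n => S (S (s n))))]].
  1: apply Hm.
  1: destruct HF as [[]|HF]; apply HF.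
  1: apply (definable_J k i (fun q r => exO (fun x => andO (fmem q x (r (s n)))
       (forceF F q (scons x (fun n => r (s n))) A)))).
  2: apply (definable_J k i (fun q r => exO (fun x => andO (F q x (r (s n)) (r (s n0)))
       (forceF F q (scons x (fun n => r (s n))) A)))).
  all: apply definable_ex, definable_and; [|apply (IH (S (S k)) 1 0 (fun n => S (S (s n))))].
  1: apply Hm.
  destruct HF as [[]|HF]; apply HF.
Qed.

Lemma definable_force (A : form) (k i : nat) (s : nat -> nat) :
  definable false k (fun r => force (r i) (fun n => r (s n)) A).
Proof.
  apply definable_forceF; right; intros k' q f a b.
  apply (definable_conv _ _ _ (fun r => forceF (fun _ _ _ _ => botO) (r q)
    (fun n => r (scons f (scons a (scons b (fun n => n))) n)) (funf 0 1 2))); [reflexivity|].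
  apply definable_forceF; left; cbn; tauto.
Qed.

Lemma force_induction (A : form) (p : nat) (r : nat -> nat) (W : list form) :
  W ||- force p r (Imp (All (Imp (BAll 0 (rename (liftfrom 1 1) A)) A)) (All A)).
Proof.
  intros q; ii hq; ii H; apply (set_induction _ (fun x => force q (scons x r) A)).
  (* The condition [q] and the values of [r] are parameters; the induction variable occupies index
     0, hence the successors. *)
  - apply (definable_conv _ _ _ (fun e => force (e (S q)) (fun n => e (scons 0 (fun n => S (r n)) n)) A));
      [|apply definable_force].
    intros e He; rewrite (He q : e (S q) = q); f_equal; apply functional_extensionality.
    intros [|n]; [reflexivity|symmetry; apply (He (r n))].
  - ib x hx; apply (impO_app _ _ _ (impO_app _ _ _ (H x q) (subO_refl q _))).
    intros y s; ii hs; ii hy; change (forceF force_fun) with force; rewrite force_rename.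
    replace (fun n => scons y (scons x r) (liftfrom 1 1 n)) with (scons y r)
      by (apply functional_extensionality; intros [|n]; cbn; rewrite ?Nat.add_1_r; reflexivity).
    (* [y] is only forced to be an element of [x], while the induction hypothesis asks for true
       membership; [J_cut] bridges this because forcing is closed under [J]. *)
    apply force_JC, (J_cut _ (memO y x)).
    + intros k; apply definable_mem; tm.
    + apply force_mono.
    + exact (proj1 (atom_spec_mem x _ s y) hy).
    + ii h; apply (force_mono _ _ _ q); auto; app (hx y); exact h.
Qed.

End Forcing.

(** * Coding finitely many formulas by one; conservativity *)

Definition singO (z x : nat) : Omega := ev (scons z (scons x (fun n => n))) (sing 0 1).
Definition upairO (z x y : nat) : Omega :=
  ev (scons z (scons x (scons y (fun n => n)))) (upair 0 1 2).
Definition opairO (p x y : nat) : Omega :=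
  ev (scons p (scons x (scons y (fun n => n)))) (opair 0 1 2).

Lemma opair_exists (u v : nat) (W : list form) : W ||- exO (fun c => opairO c u v).
Proof.
  wp H (fun W => pair_exists u u W); iex H s hs; destruct hs as [[hs1 _] hs2].
  wp H (fun W => pair_exists u v W); iex H t ht; destruct ht as [[ht1 ht2] ht3].
  wp H (fun W => pair_exists s t W); iex H c h; destruct h as [[hc1 hc2] hc3].
  wa Hs (singO s u).
  { split; [exact hs1|]; ib a ha; pose proof (ballO_app _ _ _ _ hs2 ha) as k; ior k k; exact k. }
  wa Ht (upairO t u v).
  { split; [exact ht1|split; [exact ht2|exact ht3]]. }
  apply (exO_intro c); split; [|split].
  - ib e he; pose proof (ballO_app _ _ _ _ hc3 he) as k; ior k k.
    + apply orO_l, (eqO_subst _ (fun e => singO e u) s e); [|apply eqO_sym, k|exact Hs].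
      apply (definable_ev true 1 (fun r => scons (r 0) (scons u (fun n => n)))); [repeat constructor|env].
    + apply orO_r, (eqO_subst _ (fun e => upairO e u v) t e); [|apply eqO_sym, k|exact Ht].
      apply (definable_ev true 1 (fun r => scons (r 0) (scons u (scons v (fun n => n)))));
        [repeat constructor|env].
  - apply (bexO_intro s); auto.
  - apply (bexO_intro t); auto.
Qed.

Lemma opair_fst (c u v u' v' : nat) (W : list form) :
  W ||- opairO c u v -> W ||- opairO c u' v' -> W ||- eqO u' u.
Proof.
  intros (_ & H & _) (K & _ & _); iex H e h; destruct h as [h1 [_ h2]].
  pose proof (ballO_app _ _ _ _ K h1) as k; ior k k; destruct k as [k _]; app (h2 u'); exact k.
Qed.

Lemma opair_snd (c u v u' v' : nat) (W : list form) :
  W ||- opairO c u v -> W ||- opairO c u' v' -> W ||- orO (eqO v u') (eqO v v').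
Proof.
  intros (_ & _ & H) (K & _ & _); iex H e h; destruct h as [h1 [_ [h2 _]]].
  pose proof (ballO_app _ _ _ _ K h1) as k; ior k k.
  - destruct k as [_ k]; apply orO_l; app (k v); exact h2.
  - destruct k as [_ [_ k]]; apply (ballO_app v e _ _ k h2).
Qed.

(** Constructively, whether [u] and [v] agree cannot be decided; the two disjunctions of [opair_snd]
    replace that distinction. If both take their left side, all four components coincide. *)
Lemma opair_inj (c u v u' v' : nat) (W : list form) :
  W ||- opairO c u v -> W ||- opairO c u' v' -> W ||- andO (eqO u' u) (eqO v' v).
Proof.
  intros H H'; pose proof (opair_fst _ _ _ _ _ _ H H') as E; split; [exact E|].
  pose proof (opair_snd _ _ _ _ _ _ H H') as K.
  pose proof (opair_snd _ _ _ _ _ _ H' H) as K'.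
  ior K k; [|apply eqO_sym, k].
  ior K' k'; [|exact k'].
  apply (eqO_trans _ u); auto; apply (eqO_trans _ u'); [apply eqO_sym, E|apply eqO_sym, k].
Qed.

(* If [A] has free variables (x, u, v, params), then [compress A] has (x, c, params),
   where [c] stands for the ordered pair of [u] and [v]. *)
Definition compress (A : form) : form :=
  BEx 1 (BEx 0 (BEx 3 (BEx 0 (And (opair 5 2 0)
    (rename (scons 4 (scons 2 (scons 0 (fun n => 6 + n)))) A))))).

Lemma Delta0E_compress (A : form) : Delta0E A -> Delta0E (compress A).
Proof. intros H; repeat constructor; apply Delta0E_rename, H. Qed.

Lemma fvb_rename (A : form) : forall n m s, fvb n A -> (forall k, k < n -> s k < m) ->
  fvb m (rename s A).
Proof.
  assert (U : forall n m s, (forall k, k < n -> s k < m) -> forall k, k < S n -> up s k < S m).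
  { intros n m s H [|k] Hk; cbn; [lia|]; specialize (H k); lia. }
  induction A; cbn; intros k m s H Hs; repeat match goal with H : _ /\ _ |- _ => destruct H end;
    repeat split; eauto.
Qed.

Lemma fvb_compress (n : nat) (A : form) : fvb (3 + n) A -> fvb (2 + n) (compress A).
Proof.
  intros H; cbn; repeat split; try lia.
  apply (fvb_rename _ _ _ _ H); intros [|[|[|k]]] Hk; cbn; lia.
Qed.

Lemma ev_compress (A : form) (x c u v : nat) (r : nat -> nat) (W : list form) : Delta0E A ->
  W ||- opairO c u v ->
  W ||- iffO (ev (scons x (scons c r)) (compress A)) (ev (scons x (scons u (scons v r))) A).
Proof.
  intros D H.
  assert (E : forall v' e' u' e, ev (scons v' (scons e' (scons u' (scons e (scons x (scons c r))))))
      (rename (scons 4 (scons 2 (scons 0 (fun n => 6 + n)))) A)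
    = ev (scons x (scons u' (scons v' r))) A).
  { intros; rewrite ev_rename; f_equal; apply functional_extensionality.
    intros [|[|[|n]]]; reflexivity. }
  split; ii h.
  - cbn [ev compress] in h; iex h e h; destruct h as [he h]; iex h u' h; destruct h as [hu h].
    iex h e' h; destruct h as [he' h]; iex h v' h; destruct h as [hv [h1 h2]].
    rewrite E in h2; pose proof (opair_inj _ _ _ _ _ _ H h1) as [k1 k2].
    apply (eqO_subst _ (fun a => ev (scons x (scons a (scons v r))) A) u' u); [|exact k1|].
    { apply (definable_ev true 1 (fun e => scons x (scons (e 0) (scons v r)))); [auto|env]. }
    apply (eqO_subst _ (fun a => ev (scons x (scons u' (scons a r))) A) v' v); [|exact k2|exact h2].
    apply (definable_ev true 1 (fun e => scons x (scons u' (scons (e 0) r)))); [auto|env].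
  - pose proof H as (_ & K1 & K2); iex K1 e k1; destruct k1 as [k1 [k2 _]].
    iex K2 e' k3; destruct k3 as [k3 [_ [k4 _]]].
    cbn [ev compress]; apply (bexO_intro e); [exact k1|]; apply (bexO_intro u); [exact k2|].
    apply (bexO_intro e'); [exact k3|]; apply (bexO_intro v); [exact k4|].
    split; [exact H|rewrite E; exact h].
Qed.

Definition codes (B A : form) : Prop :=
  forall r W, W ||- exO (fun c => allO (fun x => iffO (Th B x c) (ev (scons x r) A))).

Lemma iffO_trans (P Q R : Omega) (W : list form) :
  W ||- iffO P Q -> W ||- iffO Q R -> W ||- iffO P R.
Proof. intros [h1 h2] [h3 h4]; split; ii h; [app h3; app h1|app h2; app h4]; exact h. Qed.

(** [n] counts the parameters beyond the first. Each compression merges the first two by an ordered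
    pair, until the distinguished variable and a single parameter remain. *)
Lemma code_one (n : nat) : forall A, Delta0E A -> fvb (2 + n) A ->
  exists B, Delta0E B /\ codes B A.
Proof.
  induction n as [|n IH]; intros A D H.
  - exists A; split; auto; intros r W; apply (exO_intro (r 0)); intros x.
    assert (E : Th A x (r 0) = ev (scons x r) A).
    { apply (ev_ext_fvb 2); auto; intros [|[|k]] Hk; cbn; auto; lia. }
    rewrite E; split; ii h; exact h.
  - destruct (IH (compress A) (Delta0E_compress A D) (fvb_compress n A H)) as (B & DB & HB).
    exists B; split; auto; intros r W.
    wp K (fun W => opair_exists (r 0) (r 1) W); iex K c kc.
    wp L (fun W => HB (scons c (fun n => r (S (S n)))) W); iex L d kd.
    apply (exO_intro d); intros x; apply (iffO_trans _ _ _ _ (kd x)).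
    replace (scons x r) with (scons x (scons (r 0) (scons (r 1) (fun n => r (S (S n))))))
      by (f_equal; apply functional_extensionality; intros [|[|k]]; reflexivity).
    apply ev_compress; auto.
Qed.

(* The code [(s, c)] selects [B1] if [s] is inhabited and [B2] if [s] is empty. *)
Definition alt (B1 B2 : form) : form :=
  let t := scons 0 (fun n => S (S n)) in
  compress (And (Imp (BEx 1 (Imp Bot Bot)) (rename t B1)) (Imp (BAll 1 Bot) (rename t B2))).

Lemma Delta0E_alt (B1 B2 : form) : Delta0E B1 -> Delta0E B2 -> Delta0E (alt B1 B2).
Proof. intros; apply Delta0E_compress; repeat constructor; apply Delta0E_rename; auto. Qed.

Lemma ev_alt (B : form) (x s c : nat) :
  ev (scons x (scons s (scons c (fun n => n)))) (rename (scons 0 (fun n => S (S n))) B) = Th B x c.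
Proof.
  rewrite ev_rename; unfold Th; f_equal; apply functional_extensionality; intros [|[|n]]; reflexivity.
Qed.

(** Which formula codes [A] is known in the metatheory, so the selector is chosen outright,
    inhabited or empty, and the other conjunct of [alt] becomes vacuous. *)
Lemma codes_alt (B1 B2 A : form) : Delta0E B1 -> Delta0E B2 ->
  codes B1 A \/ codes B2 A -> codes (alt B1 B2) A.
Proof.
  intros D1 D2 H r W.
  assert (Q : W ||- exO (fun s => exO (fun c => allO (fun x =>
    iffO (ev (scons x (scons s (scons c (fun n => n))))
      (let t := scons 0 (fun n => S (S n)) in
       And (Imp (BEx 1 (Imp Bot Bot)) (rename t B1)) (Imp (BAll 1 Bot) (rename t B2))))
      (ev (scons x r) A))))).
  { destruct H as [H|H].
    - wp L (fun W => insert_weak 0 0 W); iex L s hs; destruct hs as [hs _].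
      wp K (fun W => H r W); iex K c kc.
      apply (exO_intro s), (exO_intro c); intros x; cbn; rewrite !ev_alt.
      destruct (kc x) as [k1 k2]; split; ii h.
      + app k1; destruct h as [h _]; app h; apply (bexO_intro 0); [exact hs|]; ii h'; exact h'.
      + split; ii h'; [app k2; exact h|]; apply botO_elim; app (h' 0); exact hs.
    - wp L (fun W => empty_exists W); iex L s hs.
      wp K (fun W => H r W); iex K c kc.
      apply (exO_intro s), (exO_intro c); intros x; cbn; rewrite !ev_alt.
      destruct (kc x) as [k1 k2]; split; ii h.
      + app k1; destruct h as [_ h]; app h; exact hs.
      + split; ii h'; [|app k2; exact h].
        iex h' y hy; apply botO_elim; app (hs y); apply hy. }
  iex Q s Q; iex Q c kc.
  wp K (fun W => opair_exists s c W); iex K d kd.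
  apply (exO_intro d); intros x; refine (iffO_trans _ _ _ _ _ (kc x)).
  apply ev_compress; auto; repeat constructor; apply Delta0E_rename; auto.
Qed.

Lemma code_list (L : list form) : (forall A, In A L -> Delta0E A) ->
  exists B, Delta0E B /\ forall A, In A L -> codes B A.
Proof.
  induction L as [|A L IH]; intros H.
  - exists Bot; split; [constructor|intros ? []].
  - destruct IH as (B2 & D2 & H2); [intros; apply H; right; auto|].
    destruct (fvb_exists A) as [n Hn].
    destruct (code_one n A) as (B1 & D1 & H1);
      [apply H; left; auto|eapply fvb_mono; [|exact Hn]; lia|].
    exists (alt B1 B2); split; [apply Delta0E_alt; auto|].
    intros C [<-|HC]; apply codes_alt; auto.
Qed.

Fixpoint subs (A : form) : list form :=
  A :: match A with
  | Mem _ _ | Bot => []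
  | And B C | Or B C | Imp B C => subs B ++ subs C
  | All B | Ex B | BAll _ B | BEx _ B | EAll _ _ B | EEx _ _ B => subs B
  end.

Lemma hcoded_subs (B A : form) : (forall C, In C (subs A) -> codes B (relz 0 (shift C))) -> hcoded B A.
Proof.
  assert (K : forall C, codes B (relz 0 (shift C)) -> coded B C).
  { intros C HC r W; refine (holds_eq _ _ _ (HC r W) _).
    apply f_equal, functional_extensionality; intros c.
    apply f_equal, functional_extensionality; intros x; rewrite rel_ev; reflexivity. }
  induction A; cbn; intros H; (split; [apply K, H; left; reflexivity|]); auto;
    split; (apply IHA1 || apply IHA2); intros; apply H; right; apply in_or_app; auto.
Qed.

Lemma hcoded_exists (L : list form) : exists B, Delta0E B /\ forall A, In A L -> hcoded B A.
Proof.
  destruct (code_list (map (fun C => relz 0 (shift C)) (flat_map subs L))) as (B & D & H).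
  - intros A (C & <- & _)%in_map_iff; apply Delta0E_relz.
  - exists B; split; auto; intros A HA; apply hcoded_subs; intros C HC; apply H.
    apply (in_map (fun C => relz 0 (shift C))), in_flat_map; eauto.
Qed.

Lemma relz_Delta0E (A : form) : Delta0E A -> forall k, relz k A = A.
Proof. induction 1; intros k; cbn; f_equal; auto. Qed.

Lemma force_axiom (B A : form) : Delta0E B -> hcoded B (Mem 0 1) -> hcoded B (funf 0 1 2) -> hcoded B A ->
  IKPE_Ref A -> forall W p r, W ||- force B p r A.
Proof.
  intros D CM CF C [HA|HA] W p r; [|destruct HA as [A HA]].
  2: { apply force_reflection; auto; [apply CM|apply polar_SigmaPi, HA]. }
  destruct HA as [A HA| | | |A HA|A HA|A|];
    try (apply force_prenex; auto;
      [apply CM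
      |repeat first [apply prenex_All | apply prenex_Ex]; apply prenex_Delta0E;
       repeat constructor; apply Delta0E_rename; exact HA
      |rewrite ev_prov; apply r_ax, IKPE_ax_rename; constructor; exact HA]).
  (* The conclusion of Collection says that its Sigma premise [X] holds relativized to some set, so
     the axiom is a universally quantified instance of Reflection and is forced for the same
     reason. *)
  - set (X := BAll 0 (Ex (rename (liftfrom 2 1) A))).
    assert (E : BAll 1 (BEx 1 (rename (liftfrom 2 2) A)) = relz 0 (shift X)).
    { cbn; rewrite rename_comp, (relz_Delta0E _ (Delta0E_rename A HA _)); do 3 f_equal.
      apply functional_extensionality; intros [|[|n]]; cbn; rewrite ?Nat.add_1_r, ?(Nat.add_comm _ 2);
        reflexivity. }
    fold X in C |- *; rewrite E in C |- *; intros x; apply force_reflection; auto; [apply CM| |apply C].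
    split; [reflexivity|apply polar_Delta0E, Delta0E_rename, HA].
  - apply force_induction; auto; apply CM.
Qed.

Theorem theorem4p29 : forall A : form,
  sentence A -> SigmaE A ->
  prv IKPE_Ref nil A -> prv IKPE_ax nil A.
Proof.
  intros A _ HS HP.
  destruct (prv_finite _ _ _ HP) as (L & HL & HP').
  (* Besides [A] and the axioms used, membership and [funf] must be coded, because the guards of the
     bounded quantifiers are forced through them. *)
  destruct (hcoded_exists (Mem 0 1 :: funf 0 1 2 :: A :: L)) as (B & D & HB).
  assert (CM : hcoded B (Mem 0 1)) by (apply HB; cbn; auto).
  assert (CF : hcoded B (funf 0 1 2)) by (apply HB; cbn; auto).
  assert (CA : hcoded B A) by (apply HB; cbn; auto).
  assert (S : polar true A) by (apply polar_SigmaPi, HS).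
  assert (K : @nil form ||- ev (fun n => n) A).
  { wp H (fun W => empty_exists W); iex H p hp.
    assert (F : V ||- force B p (fun n => n) A).
    { apply (force_sound B (fun C => In C L) nil); auto.
      - intros C HC W q r; apply force_axiom; auto; apply HB; cbn; auto.
      - intros C []. }
    apply (sound_t B _ _ _ _ _ (force_key B D (proj1 CM) CF A true CA S)) in F; iex F z hz.
    apply (rel_true A _ z); auto; app hz; ib a ha; apply botO_elim; app (hp a); exact ha. }
  rewrite ev_prov, rename_id in K; exact K.
Qed.
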